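(* Let $G$ be a finite group and, for $n\ge 0$, let $Q_n(G)$ be the rank-$n$ Dowling lattice associated to $G$. For every $n\ge 0$, the chain polynomial $c_{Q_n(G)}$ is real-rooted with all zeros in $[-1,0]$, and the zeros of $c_{Q_n(G)}$ interlace the zeros of $c_{Q_{n+1}(G)}$, i.e. $c_{Q_n(G)}\preceq c_{Q_{n+1}(G)}$. Moreover, if $S$ is a set of nonnegative integers, then for every natural number $n$ the chain polynomial of the rank selected subposet $Q_n(G)_S$ is real-rooted and all of its zeros lie in the interval $[-1,0]$.
   Context: The chain polynomial of a finite poset $P$ is $c_P=\sum_{k\ge 0}c_k(P)t^k$, where $c_k(P)$ is the number of $k$-element chains of $P$. Dowling lattice: let $[n]=\{1,\dots,n\}$. A $G$-labeled set is a pair $(B,\alpha)$ with $B$ a set and $\alpha:B\to G$ a function; $(B,\alpha)$ and $(B,\beta)$ are equivalent if there is $g\in G$ with $\beta(b)=g\alpha(b)$ for all $b\in B$, and $[B,\alpha]$ denotes the equivalence class. A partial $G$-partition of $[n]$ is a (possibly empty) set $\gamma=\{[S_1,\alpha_1],\dots,[S_k,\alpha_k]\}$ where $S_1,\dots,S_k$ are pairwise disjoint nonempty subsets of $[n]$. The Dowling lattice $Q_n(G)$ is the set of all partial $G$-partitions of $[n]$ ordered as follows: $\gamma\le\delta$ if for every $[T,\beta]\in\delta$, the set $T$ is a union of sets $S$ with $[S,\alpha]\in\gamma$, and for each such $S\subseteq T$ one has $[S,\beta|_S]=[S,\alpha]$. It is a geometric lattice of rank $n$, where a partial $G$-partition with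 $k$ blocks has rank $n-k$. For a graded poset $P$ with rank function $\rho$ and a set $S$ of nonnegative integers, $P_S=\{x\in P:\rho(x)\in S\}$ with the induced order. Interlacing: for real-rooted $f,g$ with positive leading coefficients and zeros $\cdots\le\alpha_2\le\alpha_1$ and $\cdots\le\beta_2\le\beta_1$ respectively, the zeros of $g$ interlace those of $f$, written $g\preceq f$, if $\cdots\le\beta_2\le\alpha_2\le\beta_1\le\alpha_1$ (in particular, the degrees differ by at most one). *)

(* Defs.v *)
From HB Require Import structures.
From mathcomp Require Import boolp classical_sets.
From mathcomp Require Import all_boot all_order all_algebra all_fingroup.
From mathcomp Require Import reals.
From mathcomp Require Import complex.
Set Implicit Arguments.
Unset Strict Implicit.
Unset Printing Implicit Defensive.
Import Order.TTheory GRing.Theory Num.Theory.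
Local Open Scope ring_scope.

Section FinitePosets.
Variables (d : Order.disp_t) (P : finPOrderType d).
Implicit Types (A : {set P}) (x : P).

Definition is_chain A : bool :=
  [forall x in A, forall y in A, (x >=< y)%O].

Definition num_chains (k : nat) : nat :=
  #|[set A : {set P} | is_chain A & #|A| == k]|.

(* A chain of P has at most #|P| elements, so the sum over all k is finite. *)
Definition chain_poly (R : realType) : {poly R} :=
  \sum_(k < #|P|.+1) (num_chains k)%:R *: 'X^k.

(* The rank of x in a graded poset, as the length of the longest chains ending
   at x (x itself is not counted, so that minimal elements have rank 0). *)
Definition poset_rank x : nat :=
  \max_(A : {set P} | is_chain A && [forall y in A, (y < x)%O]) #|A|.

Definition rank_selected (S : set nat) : Type := {x : P | poset_rank x \in S}.

End FinitePosets.
Arguments chain_poly {d} P R.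
Arguments rank_selected {d} P S.

HB.instance Definition _ (d : Order.disp_t) (P : finPOrderType d)
  (S : set nat) := SubFinite.on (rank_selected P S).
HB.instance Definition _ (d : Order.disp_t) (P : finPOrderType d)
  (S : set nat) := [SubChoice_isSubPOrder of rank_selected P S by <: with d].

Section Zeros.
Variable R : realType.
Implicit Types (p f g : {poly R}) (s : seq R).

Definition real_rooted p : Prop :=
  forall z : R[i], root (map_poly (real_complex R) p) z -> complex.Im z = 0.

(* s lists the zeros of p, with multiplicity, in nonincreasing order. *)
Definition zeros_of p s : Prop :=
  p = lead_coef p *: \prod_(a <- s) ('X - a%:P) /\
  sorted (fun x y => y <= x) s.

(* interlaces g f is g \preceq f.  With zero-based indices, a`_i and b`_i are
   the zeros alpha_(i+1) of f and beta_(i+1) of g. *)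
Definition interlaces g f : Prop :=
  [/\ real_rooted g, real_rooted f, 0 < lead_coef g, 0 < lead_coef f &
   exists b a : seq R,
     [/\ zeros_of g b, zeros_of f a,
         size a = size b \/ size a = (size b).+1,
         (forall i, (i < size b)%N -> b`_i <= a`_i) &
         (forall i, (i.+1 < size a)%N -> a`_i.+1 <= b`_i)]].

End Zeros.

Section GLabelings.
Variables (n : nat) (G : finGroupType).
Local Open Scope group_scope.

(* A G-labeled set (B, alpha) with B a subset of 'I_n is encoded as the function
   equal to Some (alpha i) for i in B and to None outside of B. *)
Local Notation labeled_set := {ffun 'I_n -> option G}.

Definition carrier (f : labeled_set) : {set 'I_n} := [set i | f i != None].

Definition relabel (g : G) (f : labeled_set) : labeled_set :=
  [ffun i => omap (fun a => g * a) (f i)].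

(* The equivalence class [B, alpha]. *)
Definition labeled_class (f : labeled_set) : {set labeled_set} :=
  [set relabel g f | g : G].

Definition restrict (f : labeled_set) (B : {set 'I_n}) : labeled_set :=
  [ffun i => if i \in B then f i else None].

(* The underlying set of a class: the common carrier of its members. *)
Definition block (c : {set labeled_set}) : {set 'I_n} :=
  \bigcup_(f in c) carrier f.

Definition is_partial_partition (gam : {set {set labeled_set}}) : bool :=
  [forall c in gam,
     [exists f, (c == labeled_class f) && (carrier f != set0)]] &&
  [forall c in gam, forall c' in gam,
     (c != c') ==> [disjoint block c & block c']].

Record dowling : Type := Dowling {
  classes_of :> {set {set labeled_set}};
  _ : is_partial_partition classes_of }.

HB.instance Definition _ := [isSub for classes_of].
HB.instance Definition _ := [Finite of dowling by <:].

Definition dowling_le (gam del : dowling) : bool :=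
  [forall c in classes_of del, forall b in c,
     [exists A : {set {set labeled_set}},
        (A \subset classes_of gam) &&
        (carrier b == \bigcup_(e in A) block e)] &&
     [forall e in classes_of gam,
        (block e \subset carrier b) ==>
        (labeled_class (restrict b (block e)) == e)]].

Lemma relabel1 f : relabel 1 f = f.
Proof. by apply/ffunP => i; rewrite ffunE; case: (f i) => //= a; rewrite mul1g. Qed.

Lemma relabelM g h f : relabel g (relabel h f) = relabel (g * h) f.
Proof. by apply/ffunP => i; rewrite !ffunE; case: (f i) => //= a; rewrite mulgA. Qed.

Lemma carrier_relabel g f : carrier (relabel g f) = carrier f.
Proof. by apply/setP => i; rewrite !inE ffunE; case: (f i). Qed.

Lemma labeled_class_id f : f \in labeled_class f.
Proof. by apply/imsetP; exists 1; rewrite ?relabel1. Qed.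

Lemma block_class f : block (labeled_class f) = carrier f.
Proof.
apply/setP => i; apply/bigcupP/idP => [[h /imsetP[g _ ->]]|fi].
  by rewrite carrier_relabel.
by exists f => //; exact: labeled_class_id.
Qed.

Lemma labeled_class_relabel g f : labeled_class (relabel g f) = labeled_class f.
Proof.
apply/setP => h; apply/imsetP/imsetP => [[k _ ->]|[k _ ->]].
  by exists (k * g); rewrite ?relabelM.
by exists (k * g^-1); rewrite // relabelM -mulgA mulVg mulg1.
Qed.

Lemma restrict_relabel g f B :
  restrict (relabel g f) B = relabel g (restrict f B).
Proof. by apply/ffunP => i; rewrite !ffunE; case: (i \in B). Qed.

Lemma restrict_carrier f : restrict f (carrier f) = f.
Proof. by apply/ffunP => i; rewrite ffunE inE; case: (f i). Qed.

Lemma restrict_restrict f (B C : {set 'I_n}) :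
  C \subset B -> restrict (restrict f B) C = restrict f C.
Proof.
move=> /subsetP sCB; apply/ffunP => i; rewrite !ffunE.
by case: ifP => // /sCB ->.
Qed.

Lemma dowlingP (gam : dowling) c : c \in classes_of gam ->
  [/\ block c != set0, exists f, f \in c,
      forall f, f \in c -> c = labeled_class f &
      forall f, f \in c -> carrier f = block c].
Proof.
case: gam => gam /= /andP[/forall_inP + _] cgam => /(_ c cgam).
case/existsP => f /andP[/eqP-> f0]; rewrite block_class; split => //.
- by exists f; exact: labeled_class_id.
- by move=> h /imsetP[g _ ->]; rewrite labeled_class_relabel.
- by move=> h /imsetP[g _ ->]; rewrite carrier_relabel.
Qed.

Lemma dowling_eq (gam : dowling) c c' i :
  c \in classes_of gam -> c' \in classes_of gam ->
  i \in block c -> i \in block c' -> c = c'.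
Proof.
case: gam => gam /= /andP[_ /forall_inP dis] cg c'g ic ic'.
have /forall_inP/(_ c' c'g) := dis c cg.
case: eqVneq => //= _ /pred0P/(_ i) /=.
by rewrite ic ic'.
Qed.

Lemma dowling_leP (gam del : dowling) :
  reflect (forall c, c \in classes_of del ->
     (forall i, i \in block c ->
       exists2 e, e \in classes_of gam & (i \in block e) && (block e \subset block c)) /\
     (forall e b, e \in classes_of gam -> b \in c -> block e \subset block c ->
       labeled_class (restrict b (block e)) = e))
   (dowling_le gam del).
Proof.
apply: (iffP idP) => [/forall_inP le c cd|le].
  have [_ [f fc] _ carE] := dowlingP cd.
  have /forall_inP {}le := le c cd.
  split=> [i ic|e b eg bc ec].
    have /andP[/existsP[A /andP[/subsetP AG /eqP bE]] _] := le f fc.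
    move: ic; rewrite -(carE f fc) bE => /bigcupP[e eA ie].
    exists e; first exact: AG.
    by rewrite ie; apply/subsetP => j je; apply/bigcupP; exists e.
  have /andP[_ /forall_inP/(_ e eg)] := le b bc.
  by rewrite (carE b bc) ec => /eqP.
apply/forall_inP => c cd; apply/forall_inP => b bc.
have [_ _ _ carE] := dowlingP cd; have [cov lab] := le c cd.
rewrite (carE b bc); apply/andP; split.
  apply/existsP.
  exists [set e in classes_of gam | block e \subset block c].
  apply/andP; split; first by apply/subsetP => e; rewrite inE => /andP[].
  apply/eqP/setP => i; apply/idP/bigcupP => [/cov[e eg /andP[ie ec]]|[e]].
    by exists e => //; rewrite inE eg.
  by rewrite inE => /andP[_ /subsetP sec] /sec.
by apply/forall_inP => e eg; apply/implyP => ec; rewrite lab.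
Qed.

Lemma dowling_le_refl : reflexive dowling_le.
Proof.
move=> gam; apply/dowling_leP => c cg; split=> [i ic|e b eg bc ec].
  by exists c => //; rewrite ic subxx.
have [/set0Pn[i ie] _ _ _] := dowlingP eg.
have -> := dowling_eq eg cg ie (subsetP ec i ie).
have [_ _ clE carE] := dowlingP cg.
by rewrite -(carE b bc) restrict_carrier -(clE b bc).
Qed.

Lemma dowling_le_anti : antisymmetric dowling_le.
Proof.
suff sub (gam del : dowling) : dowling_le gam del -> dowling_le del gam ->
    classes_of del \subset classes_of gam.
  move=> gam del /andP[gd dg]; apply/val_inj/eqP => /=.
  by rewrite eqEsubset !sub.
move=> /dowling_leP gd /dowling_leP dg; apply/subsetP => c cd.
have [/set0Pn[i ic] [b bc] clE carE] := dowlingP cd.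
have [cov lab] := gd c cd; have [e eg /andP[ie ec]] := cov i ic.
have [cov' _] := dg e eg; have [c' c'd /andP[ic' c'e]] := cov' i ie.
have c'E := dowling_eq cd c'd ic ic'; subst c'.
have eE : block e = block c by apply/eqP; rewrite eqEsubset ec.
by rewrite (clE b bc) -{1}(restrict_carrier b) (carE b bc) -eE (lab e b).
Qed.

Lemma dowling_le_trans : transitive dowling_le.
Proof.
move=> del gam eps /dowling_leP gd /dowling_leP de; apply/dowling_leP => c ce.
have [cov lab] := de c ce; split=> [i ic|e b eg bc ec].
  have [c' c'd /andP[ic' c'c]] := cov i ic; have [cov' _] := gd c' c'd.
  have [e eg /andP[ie ec']] := cov' i ic'.
  by exists e => //; rewrite ie (subset_trans ec' c'c).
have [/set0Pn[i ie] _ _ _] := dowlingP eg.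
have [c' c'd /andP[ic' c'c]] := cov i (subsetP ec i ie).
have [cov' lab'] := gd c' c'd; have [e' e'g /andP[ie' ec']] := cov' i ic'.
have eE := dowling_eq eg e'g ie ie'; subst e'.
have rc' : restrict b (block c') \in c'.
  by rewrite -{2}(lab c' b c'd bc c'c) labeled_class_id.
by rewrite -(restrict_restrict b ec') (lab' e _ eg rc' ec').
Qed.

Fact dowling_display : Order.disp_t. Proof. exact: (Order.Disp tt tt). Qed.

HB.instance Definition _ := Order.Le_isPOrder.Build dowling_display dowling
  dowling_le_refl dowling_le_anti dowling_le_trans.

End GLabelings.

(* Main.v *)
Require Import Defs.
From mathcomp Require Import classical_sets.
From mathcomp Require Import all_boot all_order all_algebra all_fingroup.
From mathcomp Require Import reals.
From mathcomp Require Import complex cauchyreals ring lra zify.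
Set Implicit Arguments.
Unset Strict Implicit.
Unset Printing Implicit Defensive.
Import Order.TTheory GRing.Theory Num.Theory.
Local Open Scope ring_scope.

(** Write m for the order of G and a_i = 1 + m i.

    Counting.  If x in Q_n(G) has k blocks, the number of elements y >= x with j
    blocks is W(k, j), the complete homogeneous symmetric polynomial of degree
    k - j in a_0, ..., a_j; it depends on x only through k (count_ge_whitney).
    This comes from counting maps of [n] to N free copies of G and a zero: each
    such coloring has a kernel in Q_n(G), exactly (1 + m N)^k colorings have a
    kernel above x, and Newton interpolation at the points 1 + m N recovers the
    numbers of kernels.  Removing the least element of a chain then expresses
    the chain polynomial of any rank selection of Q_n(G) as a power of 1 + t
    times a polynomial q_n(t), the chain polynomial of the part of the selection
    with neither the least nor the greatest element (chain_poly_selection).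

    Real zeros.  The symmetric polynomials in a_k, ..., a_j refine W, and the
    corresponding weighted chain counts F(n, k), 0 <= k <= n, satisfy a
    recursion in which row n + 1 consists of the sums
      t (f_0 + ... + f_(k-1)) + (1 + t) (f_k + ... + f_n),  f_j = a_j F(n, j),
    when the elements with n + 1 blocks are selected, and of the sums
    f_k + ... + f_n otherwise, while q_(n+1) = f_0 + ... + f_n.  Fix t in the upper half plane and put
    w = t / (1 + t).  Dividing by 1 + t replaces (t, 1 + t) by (w, 1), and the
    arguments of the entries of a row turn counterclockwise by a total angle of
    at most arg w: this property passes from row to row (tri_row_sector is the
    induction, cross_exchange its heart).  As arg w < pi, a positive combination
    of the entries does not vanish, so q_n(t) <> 0.  For a real t outside
    [-1, 0] one has w > 0, and all entries of a row have the same sign.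

    Interlacing.  When all ranks are selected, the last entry of row n > 0
    is t q_n(t), and the sector property says that t q_n(t) / q_(n+1)(t) has
    nonnegative imaginary part in the upper half plane.  By the argument of
    Hermite and Biehler (hb_above) this forces the zeros of q_(n+1) to interlace
    those of t q_n; as these zeros are nonpositive, q_n interlaces q_(n+1), and
    the common factor (1 + t)^2 preserves interlacing. *)

(** * Chains of a finite poset, removing the least element *)

Section ChainsIn.
Variables (R : realType) (d : Order.disp_t) (P : finPOrderType d).
Implicit Types (A B U : {set P}) (x y : P).

Definition chain_poly_in U : {poly R} :=
  \sum_(A : {set P} | is_chain A && (A \subset U)) 'X^#|A|.

Lemma chain_polyE : chain_poly P R = chain_poly_in setT.
Proof.
rewrite /chain_poly /chain_poly_in; apply/esym.
rewrite (partition_big (fun A => inord #|A| : 'I_#|P|.+1) xpredT) //=.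
apply: eq_bigr => k _.
have inordE A : (inord #|A| == k) = (#|A| == k).
  by rewrite -val_eqE /= inordK // ltnS max_card.
rewrite (eq_bigr (fun=> 'X^k)) => [|A /andP[_]]; last by rewrite inordE => /eqP->.
rewrite sumr_const scaler_nat /num_chains; congr (_ *+ _).
rewrite -[RHS]sum1_card -[LHS]sum1_card; apply: eq_bigl => A.
by rewrite !inE [LHS]unfold_in subsetT andbT inordE.
Qed.

Lemma chain_total A : is_chain A -> {in A &, forall x y, (x >=< y)%O}.
Proof. by move=> /forall_inP h x y xA; have /forall_inP := h x xA; apply. Qed.

Lemma chain_min A : is_chain A -> A != set0 ->
  exists2 x, x \in A & forall y, y \in A -> (x <= y)%O.
Proof.
move=> cA /set0Pn[x0 x0A].
pose x := [arg min_(x < x0 in A) #|[set y in A | (y < x)%O]|].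
have : x \in A /\ forall y, y \in A ->
    (#|[set z in A | (z < x)%O]| <= #|[set z in A | (z < y)%O]|)%N.
  by rewrite /x; case: arg_minnP => // y yA h; split.
move: x => x [xA xm]; exists x => // y yA.
have := chain_total cA xA yA; case: comparableP => //= yx _.
have := xm y yA; rewrite leqNgt => /negP[]; apply: proper_card.
apply/properP; split.
  by apply/subsetP => z; rewrite !inE => /andP[-> /lt_trans]; apply.
by exists y; rewrite !inE yA ?yx // ltxx.
Qed.

Lemma chain_insert A x : (forall y, y \in A -> (x >=< y)%O) ->
  is_chain (x |: A) = is_chain A.
Proof.
move=> xA; apply/idP/idP => cA.
  apply/forall_inP => y yA; apply/forall_inP => z zA.
  by apply: (chain_total cA); rewrite inE ?yA ?zA orbT.
apply/forall_inP => y /setU1P[->|yA]; apply/forall_inP => z /setU1P[->|zA].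
- exact: comparablexx.
- exact: xA.
- by rewrite comparable_sym xA.
exact: (chain_total cA).
Qed.

(** A nonempty chain is its least element x together with a chain above x. *)
Lemma chain_poly_in_rec U : chain_poly_in U =
  1 + 'X * \sum_(x in U) chain_poly_in [set y in U | (x < y)%O].
Proof.
have c0 : is_chain (set0 : {set P}) by apply/forall_inP => x; rewrite inE.
rewrite /chain_poly_in (bigD1 set0) ?c0 ?sub0set //= cards0 expr0; congr (_ + _).
rewrite mulr_sumr.
under [RHS]eq_bigr => x xU.
  have -> : 'X * (\sum_(A : {set P} | is_chain A &&
        (A \subset [set y in U | (x < y)%O])) 'X^#|A|) =
    \sum_(A : {set P} | [&& is_chain A, A \subset U & A != set0] &&
      ((x \in A) && [forall y in A, (x <= y)%O])) 'X^#|A| :> {poly R}.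
    rewrite mulr_sumr.
    rewrite [RHS](reindex_onto (fun A => x |: A) (fun A => A :\ x)); last first.
      by move=> A /and3P[_ xA _]; rewrite setD1K.
    apply: eq_big => [A|A /andP[_ sA]].
      apply/andP/andP => [[cA sA]|[]].
        have xA y : y \in A -> (x < y)%O.
          by move/(subsetP sA); rewrite inE => /andP[].
        have nx : x \notin A by apply/negP => /xA; rewrite ltxx.
        rewrite chain_insert => [|y /xA/lt_comparable //].
        rewrite cA setU11 setU1K // eqxx; split=> //.
        rewrite subUset sub1set xU (subset_trans sA) /=; last first.
          by apply/subsetP => y; rewrite inE => /andP[].
        apply/andP; split; first by apply/set0Pn; exists x; rewrite setU11.
        by apply/forall_inP => y /setU1P[->|/xA/ltW].
      move=> /andP[/and3P[cA sA _] /andP[_ /forall_inP mA]] /eqP AE.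
      have nx : x \notin A by rewrite -AE !inE eqxx.
      have xA y : y \in A -> (x < y)%O.
        move=> yA; rewrite lt_neqAle mA ?inE ?yA ?orbT // andbT.
        by apply: contraNneq nx => ->.
      rewrite chain_insert in cA => [|y /xA/lt_comparable //].
      split=> //; apply/subsetP => y yA.
      by rewrite inE xA // andbT (subsetP sA) // inE yA orbT.
    have nx : x \notin A by apply/negP => /(subsetP sA); rewrite inE ltxx andbF.
    by rewrite cardsU1 nx exprS.
  over.
(* Each nonempty chain is counted once, at its least element. *)
rewrite (exchange_big_dep (fun A => [&& is_chain A, A \subset U & A != set0])) /=;
  last by move=> x A _ /andP[].
apply: eq_big => [A|A]; first by rewrite andbA.
rewrite -andbA => /and3P[cA sA A0]; have [x xA xm] := chain_min cA A0.
rewrite (big_pred1 x) // => y; rewrite cA sA A0 /=.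
apply/and3P/eqP => [[yU yA /forall_inP ym]|->].
  by apply/eqP; rewrite eq_le xm // ym.
by rewrite (subsetP sA) // xA; split=> //; apply/forall_inP.
Qed.

End ChainsIn.

Lemma sum_by_level (V : nmodType) (T : finType) (Q : pred T) (b : T -> nat) N
    (F : nat -> V) : (forall y, Q y -> (b y < N)%N) ->
  \sum_(y | Q y) F (b y) = \sum_(0 <= j < N) F j *+ #|[set y | Q y & b y == j]|.
Proof.
move=> bN; rewrite big_mkord; case: N bN => [|N] bN.
  by rewrite big_ord0 big_pred0 // => y; apply/negP => /bN.
rewrite (partition_big (fun y => inord (b y) : 'I_N.+1) xpredT) //=.
apply: eq_bigr => j _.
have inordE y : Q y -> (inord (b y) == j) = (b y == j).
  by move=> /bN bj; rewrite -val_eqE /= inordK.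
rewrite (eq_bigr (fun=> F j)) => [|y /andP[Qy]]; last by rewrite inordE // => /eqP->.
rewrite sumr_const; congr (_ *+ _).
rewrite -[RHS]sum1_card -[LHS]sum1_card; apply: eq_bigl => y.
by rewrite !inE [LHS]unfold_in; case Qy: (Q y); rewrite //= inordE.
Qed.

(** * The Whitney triangle and its refinement *)

Section Triangle.
Variables (a : nat -> nat) (e : pred nat).

(** Entry (n, k), for k <= n, of the triangle F whose rows carry the sector
    property.  With diag for its diagonal, F(n, k) is the sum over j of
    h_(n-j)(a_k, ..., a_j) diag j (see tri_row_whitney), where h_d is the
    complete homogeneous symmetric polynomial of degree d; for k = 0 these are
    the Whitney numbers.  The definition is over any commutative ring, so that substituting a
    number for the indeterminate is an instance of rmorph_core. *)
Fixpoint tri_row (A : comNzRingType) (x : A) (n k : nat) : A :=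
  if n is n'.+1 then
    (if e n then x * \sum_(0 <= j < n) (a j)%:R * tri_row x n' j else 0) +
    \sum_(k <= j < n) (a j)%:R * tri_row x n' j
  else 1.

(** In the application, the polynomial counting the chains of selected elements
    lying strictly between an element with n blocks and the top; 1 if n = 0. *)
Definition core (A : comNzRingType) (x : A) (n : nat) : A :=
  if n is n'.+1 then \sum_(0 <= j < n) (a j)%:R * tri_row x n' j else 1.

(** In the application, for n > 0, the chains with a prescribed least element
    having n blocks and avoiding the top: zero if e excludes n. *)
Definition diag (A : comNzRingType) (x : A) (n : nat) : A := tri_row x n n.

Lemma tri_rowS (A : comNzRingType) (x : A) n k :
  tri_row x n.+1 k = (if e n.+1 then x * core x n.+1 else 0) +
    \sum_(k <= j < n.+1) (a j)%:R * tri_row x n j.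
Proof. by []. Qed.

Lemma diagS (A : comNzRingType) (x : A) n :
  diag x n.+1 = if e n.+1 then x * core x n.+1 else 0.
Proof. by rewrite /diag tri_rowS [X in _ + X]big_geq ?addr0. Qed.

Lemma tri_row_step (A : comNzRingType) (x : A) n k : (k <= n)%N ->
  tri_row x n.+1 k = tri_row x n.+1 k.+1 + (a k)%:R * tri_row x n k.
Proof. by move=> kn; rewrite !tri_rowS [in LHS]big_ltn // addrAC addrA. Qed.

Lemma tri_row0S (A : comNzRingType) (x : A) n :
  tri_row x n.+1 0 = diag x n.+1 + core x n.+1.
Proof. by rewrite diagS tri_rowS. Qed.

Lemma rmorph_tri_row (A B : comNzRingType) (phi : {rmorphism A -> B}) x n k :
  phi (tri_row x n k) = tri_row (phi x) n k.
Proof.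
elim: n k => [|n IHn] k; first exact: rmorph1.
rewrite !tri_rowS /core rmorphD fun_if rmorphM !rmorph_sum rmorph0.
by congr ((if _ then _ * _ else _) + _); apply: eq_bigr => j _;
  rewrite rmorphM rmorph_nat IHn.
Qed.

Lemma rmorph_core (A B : comNzRingType) (phi : {rmorphism A -> B}) x n :
  phi (core x n) = core (phi x) n.
Proof.
case: n => [|n]; first exact: rmorph1.
rewrite /core rmorph_sum; apply: eq_bigr => j _.
by rewrite rmorphM rmorph_nat rmorph_tri_row.
Qed.

(** The complete homogeneous symmetric polynomial of degree k + d - j in
    a_k, ..., a_j: a monomial contains a_k (second term) or does not. *)
Fixpoint whitney_from (d k j : nat) : nat :=
  if d is d'.+1 then (whitney_from d' k.+1 j + a k * whitney_from d' k j)%N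
  else (j == k).

(** For a_i = 1 + m i, the Whitney numbers of the second kind of the Dowling
    lattice of a group of order m. *)
Definition whitney n j := whitney_from n 0 j.

Lemma whitney_from_gt d k j : (k + d < j)%N -> whitney_from d k j = 0%N.
Proof.
elim: d k => [|d IHd] k kdj /=; first by apply/eqP; rewrite eqb0; lia.
by rewrite !IHd ?muln0 //; lia.
Qed.

Lemma whitney_from_top d k : whitney_from d k (k + d) = 1%N.
Proof.
elim: d k => [|d IHd] k /=; first by rewrite addn0 eqxx.
by rewrite addnS -addSn IHd whitney_from_gt ?muln0 //; lia.
Qed.

Lemma whitney_from_lt d k j : (j < k)%N -> whitney_from d k j = 0%N.
Proof.
elim: d k => [|d IHd] k jk /=; first by apply/eqP; rewrite eqb0; lia.
by rewrite !IHd ?muln0 //; lia.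
Qed.

Lemma whitneyn0 n : a 0 = 1%N -> whitney n 0 = 1%N.
Proof.
move=> a0; rewrite /whitney; elim: n => //= n ->.
by rewrite whitney_from_lt // a0.
Qed.

Lemma whitneynn n : whitney n n = 1%N.
Proof. exact: (whitney_from_top n 0). Qed.

(** Both sides satisfy the recursion tri_row_step, which is the one defining
    whitney_from, and agree on the diagonal. *)
Lemma tri_row_whitney (A : comNzRingType) (x : A) d k :
  tri_row x (k + d) k = \sum_(0 <= j < (k + d).+1) (whitney_from d k j)%:R * diag x j.
Proof.
elim: d k => [|d IHd] k.
  rewrite addn0 big_nat_recr //= eqxx mul1r big_nat big1 ?add0r // => j jk.
  by rewrite (_ : j == k = false) ?mul0r //; lia.
rewrite addnS tri_row_step ?leq_addr // IHd -addSn IHd mulr_sumr.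
rewrite [in LHS]addSn [in RHS]addSn.
rewrite [X in _ = X]big_nat_recr // [X in X + _ = _]big_nat_recr //=.
rewrite (@whitney_from_gt d k (k + d).+1) // muln0 addn0 -addrA [X in _ + X]addrC addrA.
rewrite -big_split; congr (_ + _); apply: eq_bigr => j _.
by rewrite natrD natrM mulrDl mulrA.
Qed.

(** This is the recursion that removes the least element of a chain, so it
    identifies core with a chain count. *)
Lemma core_whitney (A : comNzRingType) (x : A) n :
  core x n.+1 = \sum_(0 <= j < n.+1) (whitney n.+1 j)%:R * diag x j.
Proof.
apply: (addrI (diag x n.+1)); rewrite -tri_row0S.
have := tri_row_whitney x n.+1 0; rewrite add0n => ->.
by rewrite big_nat_recr // -/(whitney n.+1 n.+1) whitneynn mul1r addrC.
Qed.

(** Newton interpolation of a power: the complete symmetric polynomials are the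
    divided differences of monomials. *)
Lemma whitney_newton_from (A : comNzRingType) (z : A) d k :
  \sum_(0 <= j < (k + d).+1)
     (whitney_from d k j)%:R * \prod_(k <= i < j) (z - (a i)%:R) = z ^+ d.
Proof.
elim: d k => [|d IHd] k.
  rewrite addn0 big_nat_recr //= eqxx mul1r [X in _ + X]big_geq //.
  rewrite big_nat big1 ?add0r // => j jk.
  by rewrite (_ : j == k = false) ?mul0r //; lia.
have e1 : \sum_(0 <= j < (k + d.+1).+1) (whitney_from d k.+1 j)%:R *
   \prod_(k <= i < j) (z - (a i)%:R) = (z - (a k)%:R) * z ^+ d.
  rewrite -[in RHS](IHd k.+1) addSnnS mulr_sumr; apply: eq_big_nat => j jk.
  case: (ltnP j k.+1) => jk1; first by rewrite whitney_from_lt //= !mul0r mulr0.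
  by rewrite [in LHS]big_ltn // mulrCA.
have e2 : \sum_(0 <= j < (k + d.+1).+1) (a k * whitney_from d k j)%:R *
   \prod_(k <= i < j) (z - (a i)%:R) = (a k)%:R * z ^+ d.
  rewrite -[in RHS](IHd k) addnS big_nat_recr //=.
  rewrite (@whitney_from_gt d k (k + d).+1) // muln0 mul0r addr0 mulr_sumr.
  by apply: eq_bigr => j _; rewrite natrM mulrA.
under eq_bigr do rewrite /= natrD mulrDl.
by rewrite big_split /= e1 e2 -mulrDl subrK exprS.
Qed.

Lemma whitney_newton (A : comNzRingType) (z : A) n :
  \sum_(0 <= j < n.+1) (whitney n j)%:R * \prod_(0 <= i < j) (z - (a i)%:R) =
    z ^+ n.
Proof. exact: (whitney_newton_from z n 0). Qed.

End Triangle.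

(** * Chain polynomials of posets with Whitney level counts *)

Section Levels.
Variables (R : realType) (a : nat -> nat) (tau : pred nat).
Hypothesis a0 : a 0 = 1%N.

(** The chain polynomial of the selected elements strictly above an element with
    k blocks; the exponent says whether the top is selected and distinct from
    that element. *)
Definition level_poly (k : nat) : {poly R} :=
  (1 + 'X) ^+ ((0 < k)%N && tau 0%N) * core a tau 'X k.

Definition level_count k j := if tau j then whitney a k j else 0%N.

(** The term j = 0 is the top; factoring 1 + 'X out of the other terms leaves
    core_whitney. *)
Lemma level_poly_rec k :
  1 + 'X * \sum_(0 <= j < k) level_poly j *+ level_count k j = level_poly k.
Proof.
under eq_bigr do rewrite -mulr_natl.
case: k => [|k]; first by rewrite big_geq // mulr0 addr0 /level_poly mulr1.
have split (f : nat -> {poly R}) :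
  \sum_(0 <= j < k.+1) f j = f 0%N + \sum_(1 <= j < k.+1) f j by rewrite big_ltn.
rewrite /level_poly core_whitney !split /level_count whitneyn0 // expr0 !mul1r.
rewrite (_ : core a tau 'X 0 = 1) // mulr1 mulrDr.
set s := \sum_(1 <= j < k.+1) _; set s' := \sum_(1 <= j < k.+1) _.
have -> : 'X * s = (1 + 'X) ^+ tau 0%N * s'.
  rewrite /s /s' !mulr_sumr; apply: eq_big_nat => -[//|j] jk.
  rewrite diagS; case: ifP => _; last by rewrite mul0r !mulr0.
  by rewrite /=; ring.
by case: (tau 0%N); rewrite ?mulr1n ?mulr0n; ring.
Qed.

Variables (d : Order.disp_t) (P : finPOrderType d) (b : P -> nat) (n : nat).
Hypothesis b_lt : forall x y : P, (x < y)%O -> (b y < b x)%N.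
Hypothesis b_le : forall x : P, (b x <= n)%N.
Hypothesis count_above : forall x j, (j < b x)%N ->
  #|[set y | (x < y)%O & b y == j]| = level_count (b x) j.
Hypothesis count_all : forall j, (j <= n)%N ->
  #|[set y | b y == j]| = level_count n j.

(** By induction on b x, the chains strictly above x depend on b x only, and
    their polynomial satisfies level_poly_rec.  At the bottom, the factor
    (1 + 'X) ^+ tau n accounts for the least element. *)
Lemma chain_poly_levels :
  chain_poly P R = (1 + 'X) ^+ tau n * level_poly n.
Proof.
have h x : chain_poly_in R [set y | (x < y)%O] = level_poly (b x).
  have [k] := ubnP (b x); elim: k x => // k IHk x; rewrite ltnS => xk.
  rewrite chain_poly_in_rec -level_poly_rec; congr (1 + 'X * _).
  rewrite (eq_bigr (fun y => level_poly (b y))); last first.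
    move=> y; rewrite inE => xy; rewrite -IHk; last exact: leq_trans (b_lt xy) xk.
    congr chain_poly_in; apply/setP => z; rewrite !inE.
    by apply/andb_idl; apply: lt_trans.
  rewrite (eq_bigl (fun y => (x < y)%O)) => [|y]; last by rewrite inE.
  rewrite (@sum_by_level _ _ _ _ (b x)) => [|y]; last exact: b_lt.
  by apply: eq_big_nat => j jx; rewrite count_above.
rewrite chain_polyE chain_poly_in_rec.
rewrite (eq_bigr (fun y => level_poly (b y))) => [|y _]; last first.
  by rewrite -h; congr chain_poly_in; apply/setP => z; rewrite !inE.
rewrite (eq_bigl xpredT) => [|y]; last by rewrite inE.
rewrite (@sum_by_level _ _ _ _ n.+1) => [|y _]; last by rewrite ltnS.
rewrite big_nat_recr //= mulrDr addrA.
rewrite (eq_big_nat _ _ (F2 := fun j => level_poly j *+ level_count n j)).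
  rewrite level_poly_rec count_all // /level_count whitneynn.
  by case: (tau n); rewrite ?mulr1n ?mulr0n; ring.
by move=> j /andP[_ jn]; rewrite count_all // ltnW.
Qed.

End Levels.

(** * Sectors in the plane *)

Section Cone.
Variable R : rcfType.
Local Notation C := (complex R).
Implicit Types (u v w y z : C) (f g : nat -> C).

(** The cross product of u and v as plane vectors; if these are nonzero, it is
    nonnegative iff the angle from u to v lies between 0 and pi. *)
Definition cross u v : R := complex.Im (v * conjc u).

Lemma crossE u v :
  cross u v = complex.Re u * complex.Im v - complex.Im u * complex.Re v.
Proof. by case: u v => [a b] [c d]; rewrite /cross /=; ring. Qed.

Lemma crossDl u u' v : cross (u + u') v = cross u v + cross u' v.
Proof. by case: u u' v => [? ?] [? ?] [? ?]; rewrite !crossE /=; ring. Qed.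

Lemma crossDr u v v' : cross u (v + v') = cross u v + cross u v'.
Proof. by case: u v v' => [? ?] [? ?] [? ?]; rewrite !crossE /=; ring. Qed.

Lemma cross0l v : cross 0 v = 0.
Proof. by rewrite crossE /= !mul0r subr0. Qed.

Lemma cross0r u : cross u 0 = 0.
Proof. by rewrite crossE /= !mulr0 subr0. Qed.

Lemma crosszz u : cross u u = 0.
Proof. by rewrite crossE mulrC subrr. Qed.

Lemma crossMl w u v : cross (w * u) (w * v) =
  (complex.Re w ^+ 2 + complex.Im w ^+ 2) * cross u v.
Proof. by case: w u v => [? ?] [? ?] [? ?]; rewrite !crossE /=; ring. Qed.

Lemma crossNatl (n : nat) u v : cross (n%:R * u) v = n%:R * cross u v.
Proof.
elim: n => [|n IHn]; first by rewrite !mulr0n !mul0r cross0l.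
by rewrite -!natr1 !mulrDl !mul1r crossDl IHn.
Qed.

Lemma crossNatr (n : nat) u v : cross u (n%:R * v) = n%:R * cross u v.
Proof.
elim: n => [|n IHn]; first by rewrite !mulr0n !mul0r cross0r.
by rewrite -!natr1 !mulrDl !mul1r crossDr IHn.
Qed.

Lemma cross_suml_ge0 m n f v : (forall i, (m <= i < n)%N -> 0 <= cross (f i) v) ->
  0 <= cross (\sum_(m <= i < n) f i) v.
Proof.
move=> fv; rewrite big_nat; apply: (big_ind (fun u => 0 <= cross u v)) => //.
  by rewrite cross0l.
by move=> x y x0 y0; rewrite crossDl addr_ge0.
Qed.

Lemma cross_sumr_ge0 m n u f : (forall i, (m <= i < n)%N -> 0 <= cross u (f i)) ->
  0 <= cross u (\sum_(m <= i < n) f i).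
Proof.
move=> uf; rewrite big_nat; apply: (big_ind (fun v => 0 <= cross u v)) => //.
  by rewrite cross0r.
by move=> x y x0 y0; rewrite crossDr addr_ge0.
Qed.

(** For w in the upper half plane: f j lies in the sector between f i and w * f i
    for i <= j, so the arguments of f 0, f 1, ... increase, by at most arg w in
    total. *)
Definition sector w (n : nat) f : Prop := forall i j, (i <= j < n)%N ->
  0 <= cross (f i) (f j) /\ 0 <= cross (f j) (w * f i).

Lemma cross_sums w n f p q r s : sector w n f -> (q <= r)%N -> (s <= n)%N ->
  let u := \sum_(p <= i < q) f i in let v := \sum_(r <= i < s) f i in
  0 <= cross u v /\ 0 <= cross v (w * u).
Proof.
move=> sf qr sn; split.
  apply: cross_suml_ge0 => i iq; apply: cross_sumr_ge0 => j jq.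
  by apply: (sf i j _).1; lia.
rewrite mulr_sumr; apply: cross_suml_ge0 => i iq; apply: cross_sumr_ge0 => j jq.
by apply: (sf j i _).2; lia.
Qed.

(** The inductive step.  Passing from entry i to entry j > i of the next row turns
    a block s of summands from s into w * s, between a part u already multiplied
    by w and a part v not yet multiplied.  After expansion every term is one of
    the assumed inequalities or a square times Im w. *)
Lemma cross_exchange w (u s v : C) : 0 <= complex.Im w ->
  0 <= cross u s -> 0 <= cross s v ->
  0 <= cross s (w * u) -> 0 <= cross v (w * u) -> 0 <= cross v (w * s) ->
  let y := w * u + (s + v) in let z := w * (u + s) + v in
  0 <= cross y z /\ 0 <= cross z (w * y).
Proof.
move=> w0 us sv swu vwu vws y z; rewrite /y /z {y z}.
have nn (c : C) : 0 <= complex.Re c ^+ 2 + complex.Im c ^+ 2.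
  by rewrite addr_ge0 // sqr_ge0.
split.
  have -> : cross (w * u + (s + v)) (w * (u + s) + v) =
    cross s (w * u) + (complex.Re w ^+ 2 + complex.Im w ^+ 2) * cross u s +
    complex.Im w * (complex.Re s ^+ 2 + complex.Im s ^+ 2) +
    cross v (w * s) + cross s v.
    by case: w u s v {w0 us sv swu vwu vws} => [? ?] [? ?] [? ?] [? ?];
      rewrite !crossE /=; ring.
  by rewrite !addr_ge0 // mulr_ge0.
have -> : cross (w * (u + s) + v) (w * (w * u + (s + v))) =
    complex.Im w * (complex.Re (w * u + v) ^+ 2 + complex.Im (w * u + v) ^+ 2) +
    (complex.Re w ^+ 2 + complex.Im w ^+ 2) * (cross s (w * u) + cross s v) +
    cross v (w * s) + (complex.Re w ^+ 2 + complex.Im w ^+ 2) * cross u s.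
  by case: w u s v {w0 us sv swu vwu vws} => [? ?] [? ?] [? ?] [? ?];
    rewrite !crossE /=; ring.
by rewrite !addr_ge0 // mulr_ge0 // addr_ge0.
Qed.

Lemma sector_scale w n f c : sector w n f -> sector w n (fun k => c * f k).
Proof.
move=> sf i j ij; have [s1 s2] := sf i j ij.
have c0 : 0 <= complex.Re c ^+ 2 + complex.Im c ^+ 2 by rewrite addr_ge0 // sqr_ge0.
by rewrite mulrCA !crossMl; split; apply: mulr_ge0.
Qed.

Lemma sector_nat w n f (b : nat -> nat) :
  sector w n f -> sector w n (fun k => (b k)%:R * f k).
Proof.
move=> sf i j ij; have [s1 s2] := sf i j ij.
by rewrite mulrCA !(crossNatl, crossNatr); split; rewrite !mulr_ge0.
Qed.

Lemma cross_rot w v : cross v (w * v) =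
  complex.Im w * (complex.Re v ^+ 2 + complex.Im v ^+ 2).
Proof. by case: w v => [? ?] [? ?]; rewrite !crossE /=; ring. Qed.

Lemma cross_rot_ge0 w v : 0 <= complex.Im w -> 0 <= cross v (w * v).
Proof. by move=> w0; rewrite cross_rot mulr_ge0 // addr_ge0 // sqr_ge0. Qed.

(** The recursion for a level that is not selected. *)
Lemma sector_tails w n f : 0 <= complex.Im w -> sector w n f ->
  sector w n.+1 (fun k => \sum_(k <= j < n) f j).
Proof.
move=> w0 sf i j /andP[ij]; rewrite ltnS => jn.
rewrite (big_cat_nat ij jn) /=; set s := bigop _ _ _; set v := bigop _ _ _.
have [sv vws] := cross_sums i sf (leqnn j) (leqnn n).
split; first by rewrite crossDl crosszz addr0.
by rewrite mulrDr crossDr addr_ge0 // cross_rot_ge0.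
Qed.

(** The recursion for a selected level, after division by 1 + t. *)
Lemma sector_exchange w n f : 0 <= complex.Im w -> sector w n f ->
  sector w n.+1 (fun k =>
    w * (\sum_(0 <= j < k) f j) + \sum_(k <= j < n) f j).
Proof.
move=> w0 sf i j /andP[ij]; rewrite ltnS => jn.
rewrite [in \sum_(i <= _ < n) _](big_cat_nat ij jn).
rewrite [in \sum_(0 <= _ < j) _](big_cat_nat (leq0n i) ij) /=.
have [us swu] := cross_sums 0 sf (leqnn i) jn.
have [_ vwu] := cross_sums 0 sf ij (leqnn n).
have [sv vws] := cross_sums i sf (leqnn j) (leqnn n).
exact: cross_exchange.
Qed.

(** If the sum vanished, the later summands would add up to the opposite of the
    first one, which points out of a sector of angle less than pi. *)
Lemma sector_sum_neq0 w n f (b : nat -> nat) : 0 < complex.Im w ->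
  sector w n.+1 f -> f 0%N != 0 -> b 0%N != 0%N ->
  \sum_(0 <= j < n.+1) (b j)%:R * f j != 0.
Proof.
move=> w0 sf f0 b0; apply/eqP => s0.
have /= := cross_sums 0 (q := 1) (r := 1) (s := n.+1)
  (sector_nat b sf) isT (leqnn _).
move/eqP: s0; rewrite [X in X == 0]big_ltn // addr_eq0 => /eqP s0.
rewrite big_nat1 => -[_]; apply/negP; rewrite -ltNge.
have -> : \sum_(1 <= i < n.+1) (b i)%:R * f i = - ((b 0)%:R * f 0%N).
  by rewrite s0 opprK.
have : (b 0)%:R * f 0%N != 0 by rewrite mulf_neq0 // pnatr_eq0.
move: (_ * _) => y y0; rewrite -[- y]mulN1r.
have -> : cross (-1 * y) (w * y) = - cross y (w * y).
  by case: w y {w0 sf s0 y0} => [? ?] [? ?]; rewrite !crossE /=; ring.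
rewrite cross_rot oppr_lt0 mulr_gt0 //.
rewrite lt0r addr_ge0 ?sqr_ge0 // andbT.
apply: contra y0; rewrite paddr_eq0 ?sqr_ge0 // !sqrf_eq0 => /andP[/eqP r0 /eqP i0].
by apply/eqP; case: y r0 i0 => x z /= -> ->.
Qed.

Section Rows.
Variables (a : nat -> nat) (e : pred nat) (t : C).
Hypothesis a0 : a 0 != 0%N.
Hypothesis t0 : 0 < complex.Im t.
Let w := t / (1 + t).

Lemma shift_neq0 : 1 + t != 0.
Proof. by apply/eqP; case: t t0 => x y /= y0 [_ /eqP]; rewrite add0r gt_eqF. Qed.

Lemma Im_ratio_gt0 : 0 < complex.Im w.
Proof.
have := shift_neq0; rewrite /w; case: t t0 => x y /= y0 _.
set n2 := (1 + x) ^+ 2 + (0 + y) ^+ 2.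
have n0 : 0 < n2 by rewrite /n2 ltr_wpDl ?sqr_ge0 // exprn_gt0 // add0r.
have -> : x * - ((0 + y) / n2) + y * ((1 + x) / n2) = y / n2 by ring.
exact: divr_gt0.
Qed.

Lemma tri_row_sector n : sector w n.+1 (tri_row a e t n) /\ tri_row a e t n 0 != 0.
Proof.
have w0 := Im_ratio_gt0.
elim: n => [|n [sn n0]].
  split; last exact: oner_neq0.
  move=> i j _; split; first by rewrite crosszz.
  by apply: cross_rot_ge0; apply: ltW.
have sa := sector_nat a sn.
have c0 : core a e t n.+1 != 0 by apply: (sector_sum_neq0 w0 sn).
split; last first.
  rewrite tri_row0S diagS; case: ifP => _; last by rewrite add0r.
  by rewrite -[X in _ + X]mul1r -mulrDl mulf_neq0 // addrC shift_neq0.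
case ee: (e n.+1); last first.
  move=> i j ij; rewrite !tri_rowS ee !add0r.
  exact: (sector_tails (ltW w0) sa).
move=> i j ij; have /andP[ij' jn] := ij.
have E k : (k < n.+2)%N -> tri_row a e t n.+1 k = (1 + t) *
  (w * (\sum_(0 <= j < k) (a j)%:R * tri_row a e t n j) +
   \sum_(k <= j < n.+1) (a j)%:R * tri_row a e t n j).
  move=> kn; rewrite tri_rowS ee /core [in t * _](big_cat_nat (leq0n k) kn) /=.
  set u := bigop _ _ _; set v := bigop _ _ _.
  have tw : t = (1 + t) * w by rewrite mulrC divfK ?shift_neq0.
  by rewrite [RHS]mulrDr mulrA -tw; ring.
rewrite !E //; last exact: leq_ltn_trans jn.
exact: (sector_scale _ (sector_exchange (ltW w0) sa)).
Qed.

Lemma core_neq0 n : core a e t n != 0.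
Proof.
case: n => [|n]; first exact: oner_neq0.
have [sn n0] := tri_row_sector n.
exact: (sector_sum_neq0 Im_ratio_gt0 sn).
Qed.

(** core is a positive combination of entries that precede the diagonal one in
    the sector. *)
Lemma cross_core_diag n : 0 <= cross (core a e t n.+1) (diag a e t n).
Proof.
have [sn _] := tri_row_sector n.
apply: cross_suml_ge0 => i /andP[_ lin]; rewrite crossNatl mulr_ge0 //.
by apply: (sn i n _).1; rewrite -ltnS lin ltnSn.
Qed.

End Rows.
End Cone.

Section RealSigns.
Variables (R : realFieldType) (a : nat -> nat) (e : pred nat) (x : R).
Hypothesis a0 : a 0 != 0%N.
Hypothesis x0 : ~~ (-1 <= x <= 0).

(** Outside [-1, 0] the ratio x / (1 + x) is positive, so up to a common factor
    all entries of a row are nonnegative and the first is positive. *)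
Lemma core_real_neq0 n : core a e x n != 0.
Proof.
have x1 : 1 + x != 0 by apply: contra x0 => /eqP h; rewrite (_ : x = -1); lra.
have w0 : 0 < x / (1 + x).
  case: (ltP 0 x) => hx; first by rewrite divr_gt0 // addr_gt0.
  move: x0; rewrite hx andbT -ltNge => hx1.
  by rewrite -mulrNN -invrN divr_gt0 //; lra.
case: n => [|n]; first exact: oner_neq0.
suff pos : exists2 c, c != 0 & 0 < c * tri_row a e x n 0 /\
    forall k, 0 <= c * tri_row a e x n k.
  have [c c0 [r0 rn]] := pos.
  suff : 0 < c * core a e x n.+1 by apply: contraTneq => ->; rewrite mulr0 ltxx.
  rewrite /core big_ltn // mulrDr ltr_wpDr //.
    rewrite mulr_sumr sumr_ge0 // => i _; rewrite mulrCA mulr_ge0 //.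
  by rewrite mulrCA mulr_gt0 // ltr0n lt0n.
elim: n => [|n [c c0 [r0 rn]]]; first by exists 1; rewrite ?oner_neq0 // mul1r.
have rk k m : 0 <= c * \sum_(k <= j < m) (a j)%:R * tri_row a e x n j.
  by rewrite mulr_sumr sumr_ge0 // => i _; rewrite mulrCA mulr_ge0.
have r1 : 0 < c * core a e x n.+1.
  rewrite /core big_ltn // mulrDr ltr_wpDr //.
  by rewrite mulrCA mulr_gt0 // ltr0n lt0n.
case ee: (e n.+1); last first.
  by exists c => //; split=> [|k]; rewrite tri_rowS ee add0r.
exists (c / (1 + x)); first by rewrite mulf_neq0 // invr_neq0.
split=> [|k].
  rewrite tri_rowS ee -[\sum_(0 <= _ < _) _]/(core a e x n.+1).
  have -> : c / (1 + x) * (x * core a e x n.+1 + core a e x n.+1) =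
    c * core a e x n.+1 by field.
  exact: r1.
rewrite tri_rowS ee; case: (leqP k n.+1) => kn; last first.
  rewrite [\sum_(k <= _ < _) _]big_geq ?(ltnW kn) // addr0.
  have -> : c / (1 + x) * (x * core a e x n.+1) =
    x / (1 + x) * (c * core a e x n.+1) by field.
  by rewrite mulr_ge0 // ltW.
rewrite /core (big_cat_nat (leq0n k) kn) /=.
set u := bigop _ _ _; set v := bigop _ _ _.
have -> : c / (1 + x) * (x * (u + v) + v) = x / (1 + x) * (c * u) + c * v by field.
by rewrite addr_ge0 ?rk // mulr_ge0 ?rk // ltW.
Qed.
End RealSigns.

(** * Splitting real-rooted polynomials and passing to the limit *)

Section Splitting.
Variable R : realType.
Implicit Types (p : {poly R}) (s a b : seq R).
Local Notation C := (complex R).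

(** Roots are split off one at a time: C is algebraically closed, and the complex
    roots are real. *)
Lemma real_rooted_split p : p != 0 -> real_rooted p ->
  exists s, p = lead_coef p *: \prod_(x <- s) ('X - x%:P).
Proof.
have [n] := ubnP (size p); elim: n p => // n IHn p; rewrite ltnS => pn p0 rp.
have [s1|s1] := eqVneq (size p) 1%N.
  exists [::]; rewrite big_nil lead_coefE s1 /=.
  by rewrite {1}(size1_polyC (eq_leq s1)) alg_polyC.
have : size (map_poly (real_complex R) p) != 1 by rewrite size_map_poly.
case/closed_rootP => z rz; have z0 := rp z rz.
have {rz z0} : root p (complex.Re z).
  rewrite -(fmorph_root (real_complex R)); congr (root _ _): rz.
  by case: z z0 => x y /= ->.
move/factor_theorem => [q pE].
have q0 : q != 0 by apply: contra p0 => /eqP q0; rewrite pE q0 mul0r.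
have lq : lead_coef p = lead_coef q by rewrite pE lead_coef_Mmonic // monicXsubC.
have [||s qE] := IHn q _ q0.
- by move: pn; rewrite pE size_Mmonic ?monicXsubC // size_XsubC addn2.
- by move=> w rw; apply: rp; rewrite pE rmorphM rootM rw.
by exists (complex.Re z :: s); rewrite big_cons lq scalerAr -qE mulrC.
Qed.

End Splitting.

Section Limits.
Variable R : rcfType.
Local Notation C := (complex R).

Lemma poly_ge0_at0 (p : {poly R}) : (forall x, 0 < x -> 0 <= p.[x]) -> 0 <= p.[0].
Proof.
move=> pos; rewrite leNgt; apply/negP => p0.
have /factor_theorem[q pE] : root (p - p.[0]%:P) 0.
  by rewrite rootE hornerD hornerN hornerC subrr.
have pq x : p.[x] = p.[0] + q.[x] * x.
  by have := congr1 (fun r => r.[x]) pE;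
    rewrite hornerD hornerN hornerC hornerM hornerXsubC; lra.
have B0 := poly_bound_gt0 q 0 1; set B := poly_bound q 0 1 in B0.
(* With |q| <= B on [-1, 1], p remains negative at distance -p(0) / 2B. *)
pose x := Num.min 1 (- p.[0] / (2 * B)).
have x0 : 0 < x by rewrite lt_min ltr01 divr_gt0 ?mulr_gt0 ?oppr_gt0.
have qB : q.[x] <= B.
  apply: le_trans (ler_norm _) _; apply: poly_boundP.
  by rewrite subr0 gtr0_norm // ge_min lexx.
have xB : x * B <= - p.[0] / 2.
  rewrite -ler_pdivlMr // -mulrA -invfM ge_min lexx orbT //.
have := pos x x0; rewrite pq.
have := ler_wpM2r (ltW x0) qB; rewrite [B * x]mulrC; lra.
Qed.

(** On real points the imaginary part of q is the value of the real polynomial of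
    imaginary parts of coefficients, so the limit at 0 is a real one. *)
Lemma Im_horner_ge0 (q : {poly C}) :
  (forall x : R, 0 < x -> 0 <= complex.Im q.[real_complex R x]) ->
  0 <= complex.Im q.[0].
Proof.
have E (x : R) :
    complex.Im q.[real_complex R x] = (\poly_(i < size q) complex.Im q`_i).[x].
  rewrite horner_poly horner_coef.
  rewrite (big_morph (@complex.Im R) (id1 := 0) (op1 := +%R)) //.
    apply: eq_bigr => i _; rewrite -rmorphXn.
    by case: (q`_i) => u v /=; rewrite mulr0 add0r.
  by move=> [? ?] [? ?].
move=> pos; rewrite -(rmorph0 (real_complex R)) E.
by apply: poly_ge0_at0 => x x0; rewrite -E pos.
Qed.

End Limits.

(** * Counting the terms of a list above a point *)

Section Count.
Variable R : realFieldType.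
Implicit Types (a b p q s : seq R) (x y : R).

(** Interlacing is handled through this counting function: it turns nested
    inequalities between sorted lists into one inequality of counts, unaffected
    by common terms. *)
Definition above s x := count (fun y => x < y) s.

Lemma above_anti s x y : x <= y -> (above s y <= above s x)%N.
Proof. by move=> xy; apply: sub_count => z /= /(le_lt_trans xy). Qed.

Lemma above_next s x : uniq s -> (0 < above s x)%N ->
  exists y, [/\ y \in s, x < y & above s x = (above s y).+1].
Proof.
move=> us; rewrite /above -size_filter => fs.
have uf := filter_uniq (fun y => x < y) us.
have := sort_sorted (@le_total _ R) [seq y <- s | x < y].
have perm := permEl (perm_sort <=%R [seq y <- s | x < y]).
case: (sort _ _) perm => [|y r] perm.
  by rewrite -(perm_size perm) in fs.
rewrite /= (path_sortedE (@le_trans _ _)) => /andP[/allP yr _].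
have : y \in [seq y <- s | x < y] by rewrite -(perm_mem perm) mem_head.
rewrite mem_filter => /andP[xy ys]; exists y; split=> //.
rewrite -(perm_size perm) /=; congr _.+1.
have -> : count (fun z => y < z) s = count (fun z => y < z) [seq y <- s | x < y].
  rewrite count_filter; apply: eq_count => z /=.
  by case: (ltP y z) => //= /(lt_trans xy) ->.
rewrite -(seq.permP perm) /= ltxx add0n; apply/eqP; rewrite eq_sym -all_count.
apply/allP => z zr; rewrite lt_neqAle yr // andbT; apply: contraTneq zr => <-.
by move: uf; rewrite -(perm_uniq perm) /= => /andP[].
Qed.

(** Going down through p, above p grows by 1 at each step, so above q changes
    parity, hence grows by at least 1. *)
Lemma above_parity p q (c : bool) : uniq p ->
  {in p, forall x, odd (above q x + above p x) = c} ->
  {in p, forall x, (above p x + c <= above q x)%N}.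
Proof.
move=> up par x; have [n] := ubnP (above p x); elim: n x => // n IHn x.
rewrite ltnS => pn xp; have := par x xp.
case: (posnP (above p x)) => [->|]; first by case: c {par IHn} => //; lia.
move=> /(above_next up)[y [yp xy pxy]].
have := IHn y _ yp; rewrite -ltnS -pxy ltnS => /(_ pn).
have := above_anti q (ltW xy); rewrite pxy; case: c {par IHn} => /=; lia.
Qed.

(** Only the parity of the counts at the points of both lists enters: this is how
    sign changes, rather than the intermediate value theorem, give interlacing. *)
Lemma above_interlace a b : uniq a -> uniq b ->
  {in b, forall x, odd (above a x + above b x)} ->
  {in a, forall x, ~~ odd (above b x + above a x)} ->
  forall x, (above b x <= above a x <= (above b x).+1)%N.
Proof.
move=> ua ub ob oa x.
have hb := above_parity ub (c := true) ob.
have ha : {in a, forall x, (above a x + false <= above b x)%N}.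
  by apply: above_parity => // y ya; apply/negbTE/oa.
apply/andP; split.
  case: (posnP (above b x)) => [->//|/(above_next ub)[y [yb xy ->]]].
  by have := above_anti a (ltW xy); have := hb y yb; lia.
case: (posnP (above a x)) => [->//|/(above_next ua)[y [ya xy ->]]].
by have := above_anti b (ltW xy); have := ha y ya; lia.
Qed.

Lemma prod_sign s x : x \notin s ->
  0 < (-1) ^+ above s x * \prod_(y <- s) (x - y).
Proof.
elim: s => [|y s IHs] /=; first by rewrite big_nil mulr1 ltr01.
rewrite inE negb_or big_cons => /andP[xy /IHs]; rewrite /above /=.
case: (ltP x y) => [lt|le].
  by rewrite add1n exprS => h; rewrite mulrACA mulr_gt0 // mulN1r opprB subr_gt0.
by rewrite add0n => h; rewrite mulrCA mulr_gt0 // subr_gt0 lt_neqAle eq_sym xy.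
Qed.

Lemma nth_above s x i : sorted (fun x y => y <= x) s ->
  (i < above s x)%N = (i < size s)%N && (x < s`_i).
Proof.
elim: s i => [|y s IHs] i; first by rewrite /above ltn0 andFb.
move=> ss; rewrite /above /=.
have /= := ss; rewrite (path_sortedE (rev_trans (@le_trans _ _))).
move=> /andP[/allP ys /IHs{}IHs].
case: (ltP x y) => [xy|yx]; first by case: i => [|i] //=; rewrite add1n ltnS IHs.
have s0 : above s x = 0%N.
  apply/eqP; rewrite -leqn0 leqNgt -has_count -all_predC; apply/allP => z /ys zy /=.
  by rewrite -leNgt (le_trans zy).
rewrite -/(above s x) s0 ltn0; case: i => [|i] /=; first by rewrite ltNge yx.
by apply/esym; rewrite ltnS -IHs s0.
Qed.

Lemma exists_below s : exists x, above s x = size s.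
Proof.
suff [x xs] : exists x, all (fun y => x < y) s.
  by exists x; apply/eqP; rewrite -all_count.
elim: s => [|y s [x xs]]; first by exists 0.
exists (Num.min x y - 1); rewrite /= ltrBlDr.
apply/andP; split; first by rewrite gt_min !(ltrDl, ltr01) orbT.
apply: sub_all xs => z xz; apply: lt_trans xz.
by rewrite ltrBlDr gt_min ltrDl ltr01.
Qed.

End Count.

(** * From an inequality on the upper half plane to interlacing zeros *)

Section HermiteBiehler.
Variable R : rcfType.
Local Notation C := (complex R).
Local Notation toC := (real_complex R).
Implicit Types (a b s : seq R) (x : R) (z : C).

Definition eval_roots s z : C := \prod_(x <- s) (z - toC x).

Lemma eval_roots_real s x : eval_roots s (toC x) = toC (\prod_(y <- s) (x - y)).
Proof. by rewrite rmorph_prod; apply: eq_bigr => y _; rewrite rmorphB. Qed.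

Lemma eval_roots_conj s z : conjc (eval_roots s z) = eval_roots s (conjc z).
Proof.
rewrite rmorph_prod; apply: eq_bigr => x _.
by rewrite rmorphB /= oppr0.
Qed.

Lemma eval_roots_perm s s' : perm_eq s s' -> eval_roots s =1 eval_roots s'.
Proof. by move=> p z; apply: perm_big. Qed.

(** The expression is the imaginary part of a polynomial in the real parameter d;
    let d tend to 0. *)
Lemma eval_roots_limit a b (c z : C) x :
  (forall d : R, 0 < d -> 0 <= complex.Im
     (eval_roots a (toC x + toC d * z) * eval_roots b (toC x + toC d * conjc z) * c)) ->
  0 <= complex.Im (eval_roots a (toC x) * eval_roots b (toC x) * c).
Proof.
pose lin s w := \prod_(y <- s) (('X * w%:P + (toC x)%:P) - (toC y)%:P) : {poly C}.
have linE s w v : (lin s w).[v] = eval_roots s (toC x + v * w).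
  rewrite /lin horner_prod; apply: eq_bigr => y _.
  by rewrite !(hornerD, hornerM, hornerN, hornerC, hornerX) addrC addrA [in LHS]addrC
     -addrA [_ + - _]addrC addrA.
move=> pos.
have := @Im_horner_ge0 R (lin a z * lin b (conjc z) * c%:P).
rewrite !hornerM hornerC !linE !mul0r addr0; apply => d d0.
by rewrite !hornerM hornerC !linE; apply: pos.
Qed.

(** For m >= 2 the m-th powers of points of the upper half plane reach both half
    planes, which excludes multiple roots in hb_root. *)
Lemma root_with_sign (m : nat) (c : C) : (1 < m)%N -> complex.Im c != 0 ->
  exists2 z : C, 0 < complex.Im z & z ^+ m = c.
Proof.
move=> m1 c0; exists (m.-root c)%R; last by rewrite rootCK // ltnW.
have := Im_rootC_ge0 c m1; rewrite -complexIm ler0c le_eqVlt => /orP[/eqP i0|//].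
suff : complex.Im c = 0 by move/eqP; rewrite (negbTE c0).
rewrite -[c](rootCK (ltnW m1)); case: (m.-root c) i0 => u v /= <-.
by rewrite complexr0 -rmorphXn.
Qed.

(** Near a root x of b of multiplicity m that is not a root of a, at x + d * z, the
    sign of the expression in the hypothesis is that of Im (conj z ^ m) times a
    nonzero real number.  A constant sign for all z forces m = 1, and then determines the sign
    of that real number, which prod_sign expresses by the parity of a count. *)
Lemma hb_root (sigma : R) a b x :
  (forall z, 0 < complex.Im z ->
     0 <= sigma * cross (eval_roots b z) (eval_roots a z)) ->
  sigma != 0 -> x \in b -> x \notin a ->
  count_mem x b = 1%N /\
  sigma * (-1) ^+ (above a x + above b x) < 0.
Proof.
move=> hb s0 xb xa; set m := count_mem x b; pose b' := [seq y <- b | y != x].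
have bE z : eval_roots b z = (z - toC x) ^+ m * eval_roots b' z.
  rewrite /eval_roots (bigID (pred1 x)) /= big_filter; congr (_ * _).
  rewrite (eq_bigr (fun=> z - toC x)) => [|y /eqP->//].
  by rewrite big_const_seq iter_mulr_1.
have m0 : (0 < m)%N by rewrite -has_count has_pred1.
have xb' : x \notin b' by rewrite mem_filter eqxx.
have ab : above b x = above b' x.
  rewrite /above count_filter; apply: eq_count => y /=.
  by case: eqVneq => [->|_]; rewrite ?ltxx ?andbT ?andbF.
pose d := \prod_(y <- a) (x - y) * \prod_(y <- b') (x - y).
have dsign : 0 < (-1) ^+ (above a x + above b x) * d.
  rewrite exprD ab /d mulrACA mulr_gt0 ?prod_sign //.
have lim z : 0 < complex.Im z -> 0 <= sigma * (d * complex.Im (conjc z ^+ m)).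
  move=> z0.
  have -> : sigma * (d * complex.Im (conjc z ^+ m)) =
    complex.Im (eval_roots a (toC x) * eval_roots b' (toC x) *
                (toC sigma * conjc z ^+ m)).
    by rewrite !eval_roots_real /d; case: (conjc z ^+ m) => u v /=; ring.
  apply: (@eval_roots_limit a b' _ z) => r r0.
  pose w := toC x + toC r * z.
  have w0 : 0 < complex.Im w.
    by rewrite /w; case: z z0 {w} => u v /= v0; rewrite mul0r addr0 add0r mulr_gt0.
  have := hb w w0; rewrite bE /cross [conjc (_ * _)]rmorphM /= [conjc (_ ^+ _)]rmorphXn /=.
  rewrite !eval_roots_conj.
  have -> : conjc (w - toC x) = toC r * conjc z.
    by rewrite /w addrC addKr rmorphM /= oppr0.
  have -> : conjc w = toC x + toC r * conjc z.
    by rewrite /w rmorphD rmorphM /= !oppr0.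
  rewrite -/w; set ea := eval_roots a w; set eb := eval_roots b' _.
  rewrite exprMn -rmorphXn.
  have -> : ea * (toC (r ^+ m) * conjc z ^+ m * eb) =
     toC (r ^+ m) * (ea * eb * conjc z ^+ m) by ring.
  have -> : ea * eb * (toC sigma * conjc z ^+ m) =
     toC sigma * (ea * eb * conjc z ^+ m) by ring.
  case: (ea * eb * _) => u v /=; rewrite !mul0r !addr0 mulrCA.
  by rewrite pmulr_rge0 // exprn_gt0.
have d0 : d != 0 by apply: contraTneq dsign => ->; rewrite mulr0 ltxx.
have m1 : m = 1%N.
  apply/eqP; rewrite eqn_leq m0 andbT leqNgt; apply/negP => m2.
  have [z z0 zm] := @root_with_sign m (0 +i* 1)%C m2 (oner_neq0 _).
  have [y y0 ym] : exists2 z : C, 0 < complex.Im z & z ^+ m = (0 +i* -1)%C.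
    by apply: root_with_sign => //=; rewrite oppr_eq0 oner_neq0.
  have := lim z z0; have := lim y y0; rewrite -!rmorphXn ym zm /= opprK mulr1 mulrN1.
  rewrite mulrN oppr_ge0 => h1 h2.
  have : sigma * d != 0 by rewrite mulf_neq0.
  by case: ltgtP h1 h2.
split=> //; have := lim (0 +i* 1)%C ltr01; rewrite m1 expr1 /= mulrN1 mulrN oppr_ge0.
set k := (-1) ^+ _ in dsign *; move=> sd.
have k2 : k * k = 1 by rewrite /k -expr2 sqrr_sign.
have : sigma * k * (k * d) <= 0 by rewrite mulrA -[sigma * k * k]mulrA k2 mulr1.
rewrite pmulr_lle0 // le_eqVlt => /orP[|//].
by rewrite mulf_eq0 (negbTE s0) /k signr_eq0.
Qed.

(** One half of the Hermite-Biehler theorem.  A common root contributes a positive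
    factor to the hypothesis and equally to all counts, so it can be removed.
    Without common roots, hb_root gives the parities needed in above_interlace. *)
Lemma hb_above a b :
  (forall z, 0 < complex.Im z -> 0 <= cross (eval_roots b z) (eval_roots a z)) ->
  forall x, (above b x <= above a x <= (above b x).+1)%N.
Proof.
have [n] := ubnP (size a); elim: n a b => // n IHn a b; rewrite ltnS => an hb.
have [/hasP[x xa xb]|dis] := boolP (has (mem b) a).
  have pa := perm_to_rem xa; have pb := perm_to_rem xb.
  have {IHn}IHx y : (above (rem x b) y <= above (rem x a) y <=
      (above (rem x b) y).+1)%N.
    apply: IHn => [|z z0].
      by rewrite size_rem //; move: an; case: (a) xa => //= *; lia.
    have := hb z z0; rewrite (eval_roots_perm pa) (eval_roots_perm pb).
    rewrite /eval_roots !big_cons crossMl pmulr_rge0 //.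
    case: z z0 => u v /= v0; rewrite ltr_wpDl ?sqr_ge0 // exprn_gt0 //.
    by rewrite oppr0 addr0.
  move=> y; have := IHx y.
  by rewrite /above (seq.permP pa) (seq.permP pb) /=; lia.
have ub (x : R) : x \in b -> count_mem x b = 1%N /\ odd (above a x + above b x).
  move=> xb; have xa : x \notin a.
    by apply: contra dis => xa; apply/hasP; exists x.
  have [z z0||c1 sg] := hb_root (sigma := 1) _ _ xb xa; rewrite ?oner_neq0 //.
    by rewrite mul1r hb.
  split=> //; move: sg; rewrite -signr_odd mul1r; case: odd => //.
  by rewrite expr0 ltr10.
have ua (x : R) : x \in a -> count_mem x a = 1%N /\ ~~ odd (above b x + above a x).
  move=> xa; have xb : x \notin b.
    by apply: contra dis => xb; apply/hasP; exists x.
  have [z z0||c1 sg] := hb_root (sigma := -1) _ _ xa xb.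
  - have -> : -1 * cross (eval_roots a z) (eval_roots b z) =
      cross (eval_roots b z) (eval_roots a z) by rewrite !crossE; ring.
    exact: hb.
  - by rewrite oppr_eq0 oner_neq0.
  split=> //; move: sg; rewrite -signr_odd; case: odd => //.
  by rewrite mulrNN mulr1 ltr10.
apply: above_interlace => [||x /ub[]//|x /ua[]//].
  by apply: count_mem_uniq => x; case: (boolP (x \in a)) => [/ua[]//|/count_memPn].
by apply: count_mem_uniq => x; case: (boolP (x \in b)) => [/ub[]//|/count_memPn].
Qed.

End HermiteBiehler.
Section Interlacing.
Variable R : realType.
Local Notation C := (complex R).
Local Notation toC := (real_complex R).
Implicit Types (p q : {poly R}) (s a b : seq R).

(** For a list sorted downwards, s`_i > x holds iff more than i terms exceed x, so
    the inequalities between zeros follow by evaluating counts at zeros. *)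
Lemma interlaces_above p q b a :
  real_rooted p -> real_rooted q -> 0 < lead_coef p -> 0 < lead_coef q ->
  p = lead_coef p *: \prod_(x <- b) ('X - x%:P) ->
  q = lead_coef q *: \prod_(x <- a) ('X - x%:P) ->
  (forall x, (above b x <= above a x <= (above b x).+1)%N) ->
  interlaces p q.
Proof.
move=> rp rq lp lq pE qE ab; split=> //.
pose desc s := sort (fun x y : R => y <= x) s.
have perm s : perm_eq (desc s) s by rewrite perm_sort.
have sorted_desc s : sorted (fun x y : R => y <= x) (desc s).
  by apply: sort_sorted => x y; exact: le_total.
have aboveE s x : above (desc s) x = above s x by apply/seq.permP.
exists (desc b), (desc a).
have nth_desc s i x : (i < above s x)%N = (i < size s)%N && (x < (desc s)`_i).
  by rewrite -aboveE nth_above // (perm_size (perm s)).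
rewrite !(perm_size (perm _)).
have sba : (size b <= size a)%N.
  have [x <-] := exists_below b; have /andP[h _] := ab x.
  exact: leq_trans h (count_size _ _).
split=> //.
- by split=> //; rewrite (perm_big _ (perm b)).
- by split=> //; rewrite (perm_big _ (perm a)).
- have [x xa] := exists_below a; have /andP[_] := ab x; rewrite xa => h.
  have : (above b x <= size b)%N by apply: count_size.
  by move: h sba; move: (above b x) (size a) (size b) => u v w; lia.
- move=> i ib; rewrite leNgt; apply/negP => lt.
  have : (i < above b (desc a)`_i)%N by rewrite nth_desc ib.
  have /andP[h _] := ab (desc a)`_i; move/leq_trans => /(_ _ h).
  by rewrite nth_desc ltxx andbF.
move=> i ia; rewrite leNgt; apply/negP => lt.
have : (i.+1 < above a (desc b)`_i)%N by rewrite nth_desc ia.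
have /andP[_ h] := ab (desc b)`_i; move/leq_trans => /(_ _ h); rewrite ltnS.
by rewrite nth_desc ltxx andbF.
Qed.

Variables (m : nat -> nat).
Hypothesis m0 : m 0 != 0%N.

Section AnySelection.
Variable e : pred nat.

Lemma horner_core n (x : R) : (core m e 'X n).[x] = core m e x n.
Proof. by rewrite -[LHS]/(horner_eval x _) rmorph_core /= horner_evalE hornerX. Qed.

Lemma horner_core_complex n (z : C) :
  (map_poly toC (core m e 'X n)).[z] = core m e z n.
Proof.
by rewrite rmorph_core /= map_polyX -[LHS]/(horner_eval z _) rmorph_core /=
  horner_evalE hornerX.
Qed.

(** The lower half plane follows by conjugation, the coefficients being real. *)
Lemma core_complex_neq0 n (z : C) : complex.Im z != 0 -> core m e z n != 0.
Proof.
case: (ltgtP (complex.Im z) 0) => // [z0|z0] _; last exact: core_neq0.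
rewrite -conjc_eq0; have -> : conjc (core m e z n) = core m e (conjc z) n.
  exact: rmorph_core.
by apply: core_neq0; rewrite //; case: z z0 => x y /=; rewrite oppr_gt0.
Qed.

Lemma real_rooted_core k n : real_rooted ((1 + 'X) ^+ k * core m e 'X n : {poly R}).
Proof.
move=> z; rewrite rmorphM rootM => /orP[|]; last first.
  by rewrite /root horner_core_complex; apply: contraTeq; apply: core_complex_neq0.
rewrite rmorphXn rmorphD rmorph1 /= map_polyX /root horner_exp expf_eq0 => /andP[_].
by rewrite !hornerE; case: z => x y /eqP[_]; rewrite add0r => ->.
Qed.

Lemma root_core_itv k n (x : R) : root ((1 + 'X) ^+ k * core m e 'X n) x ->
  -1 <= x <= 0.
Proof.
rewrite rootM => /orP[|]; last first.
  by rewrite /root horner_core; apply: contraLR => h; exact: core_real_neq0.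
rewrite /root horner_exp expf_eq0 => /andP[_]; rewrite !hornerE => h; lra.
Qed.

Lemma lead_core_gt0 n : 0 < lead_coef (core m e 'X n : {poly R}).
Proof.
have nnsum k l (f : nat -> {poly R}) : (forall j i, 0 <= (f j)`_i) ->
    forall i, 0 <= (\sum_(k <= j < l) (m j)%:R * f j)`_i.
  move=> f0 i; rewrite coef_sum sumr_ge0 // => j _.
  by rewrite mulr_natl coefMn mulrn_wge0.
have nnrow l : forall k i, 0 <= (tri_row m e 'X l k : {poly R})`_i.
  elim: l => [|l IHl] k i; first by rewrite /= coef1 ler0n.
  rewrite tri_rowS coefD addr_ge0 ?nnsum //; case: ifP => _; last by rewrite coef0.
  by rewrite coefXM; case: ifP => // _; apply: nnsum.
have nn i : 0 <= (core m e 'X n : {poly R})`_i.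
  by case: n => [|n]; [rewrite coef1 ler0n | apply: nnsum].
rewrite lt0r lead_coef_eq0 lead_coefE.
rewrite nn andbT.
have : core m e (1 : R) n != 0 by apply: core_real_neq0; rewrite // ler10 andbF.
apply: contra => /eqP c0.
by rewrite -horner_core c0 horner0 eqxx.
Qed.

Lemma lead_factor_core k n :
  lead_coef ((1 + 'X) ^+ k * core m e 'X n : {poly R}) = lead_coef (core m e 'X n).
Proof. by rewrite lead_coef_monicM // monic_exp // addrC monicXaddC. Qed.

Lemma split_core n : exists s, [/\
  (core m e 'X n : {poly R}) =
     lead_coef (core m e 'X n : {poly R}) *: \prod_(x <- s) ('X - x%:P),
  forall z : C, core m e z n =
     toC (lead_coef (core m e 'X n : {poly R})) * eval_roots s z &
  all (fun x => x <= 0) s].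
Proof.
have p0 : (core m e 'X n : {poly R}) != 0.
  by rewrite -lead_coef_eq0 gt_eqF // lead_core_gt0.
have rp : real_rooted (core m e 'X n : {poly R}).
  by have := @real_rooted_core 0 n; rewrite expr0 mul1r.
have [s sE] := real_rooted_split p0 rp.
exists s; split=> // [z|].
  rewrite -horner_core_complex {1}sE map_polyZ /= hornerZ rmorph_prod horner_prod.
  congr (_ * _); apply: eq_bigr => x _.
  by rewrite rmorphB /= map_polyX map_polyC hornerXsubC.
apply/allP => x xs; have /andP[] // : -1 <= x <= 0.
apply: (@root_core_itv 0 n); rewrite expr0 mul1r sE rootZ ?gt_eqF ?lead_core_gt0 //.
by rewrite root_prod_XsubC.
Qed.

End AnySelection.

(** The sector inequality between core at n + 1 and the diagonal entry 'X * core
    at n makes the zeros of the former interlace those of the latter.  Below 0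
    the extra zero 0 counts for one, which exchanges the roles; from 0 on all
    counts vanish. *)
Lemma interlaces_core n : interlaces
  ((1 + 'X) ^+ (1 + (0 < n)) * core m predT 'X n : {poly R})
  ((1 + 'X) ^+ 2 * core m predT 'X n.+1).
Proof.
have factor k l s : (core m predT 'X l : {poly R}) =
    lead_coef (core m predT 'X l : {poly R}) *: \prod_(x <- s) ('X - x%:P) ->
  (1 + 'X) ^+ k * core m predT 'X l =
  lead_coef (core m predT 'X l : {poly R}) *:
    \prod_(x <- nseq k (-1) ++ s) ('X - x%:P).
  move=> {1}->; rewrite big_cat /= big_nseq iter_mulr_1 scalerAr.
  by rewrite rmorphN rmorph1 opprK addrC.
have [s [sE sC s0]] := split_core predT n.
have [s' [sE' sC' s0']] := split_core predT n.+1.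
apply: interlaces_above; rewrite ?lead_factor_core ?lead_core_gt0 //.
- exact: real_rooted_core.
- exact: real_rooted_core.
- exact: factor sE.
- exact: factor sE'.
move=> x; rewrite /above !count_cat !count_nseq -!/(above _ _).
case: n s sE sC s0 s' sE' sC' s0' => [|n] s sE sC s0 s' sE' sC' s0'.
  (* core is constant for n = 0 and n = 1. *)
  have nil l r : (size (core m predT 'X l : {poly R}) <= 1)%N ->
      (core m predT 'X l : {poly R}) =
      lead_coef (core m predT 'X l : {poly R}) *: \prod_(x <- r) ('X - x%:P) ->
      r = [::].
    move=> sz rE; apply: size0nil; move: sz.
    by rewrite rE size_scale ?gt_eqF ?lead_core_gt0 // size_prod_XsubC; case: size.
  rewrite (nil 0 s) ?size_poly1 // (nil 1 s') //=; first by lia.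
  by rewrite big_nat1 mulr1 -polyC_natr size_polyC leq_b1.
have hb z : 0 < complex.Im z -> 0 <= cross (eval_roots s' z) (eval_roots (0 :: s) z).
  move=> z0; have := cross_core_diag predT m0 z0 n.+1.
  rewrite diagS sC sC'.
  have := lead_core_gt0 predT n.+1; have := lead_core_gt0 predT n.+2.
  move: (lead_coef _) (lead_coef _) => c d c0 d0.
  rewrite [eval_roots (0 :: _) _]big_cons -/(eval_roots s z) rmorph0 subr0.
  rewrite mulrCA; move: (eval_roots s' z) (z * eval_roots s z) => f g.
  suff -> : cross (toC d * f) (toC c * g) = d * c * cross f g.
    by rewrite pmulr_rge0 // mulr_gt0.
  by case: f g => [? ?] [? ?]; rewrite !crossE /=; ring.
have := hb_above hb x; rewrite /above /= -!/(above _ _).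
have nil y r : 0 <= y -> all (fun x : R => x <= 0) r -> above r y = 0%N.
  move=> y0 /allP r0; apply/eqP; rewrite -leqn0 leqNgt -has_count -all_predC.
  by apply/allP => z /r0 z0 /=; rewrite -leNgt (le_trans z0).
case: (ltP x 0) => x0; first by lia.
by rewrite !nil //; lia.
Qed.

End Interlacing.

(** * Colorings and their kernels *)

Section Colorings.
Variables (n : nat) (G : finGroupType).
Local Open Scope group_scope.
Local Notation labeled_set := {ffun 'I_n -> option G}.
Local Notation coloring T := {ffun 'I_n -> option (T * G)}.

Local Notation restrict := Defs.restrict.

Section OneColorSet.
Variable T : finType.
Implicit Types (phi : coloring T) (a : T).

Definition color_part phi a : labeled_set :=
  [ffun i => if phi i is Some (b, g) then if b == a then Some g else None else None].

Definition used phi : {set T} := [set a | carrier (color_part phi a) != set0].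

Lemma color_partP phi a i :
  reflect (exists g, phi i = Some (a, g)) (i \in carrier (color_part phi a)).
Proof.
rewrite inE ffunE; case E: (phi i) => [[b g]|]; last by constructor => -[].
case: (b =P a) => [->|ne]; constructor; first by exists g.
by case=> h [/ne].
Qed.

Lemma color_part_some phi a i g : phi i = Some (a, g) ->
  color_part phi a i = Some g.
Proof. by move=> E; rewrite ffunE E eqxx. Qed.

Lemma usedP phi a : reflect (exists i g, phi i = Some (a, g)) (a \in used phi).
Proof.
rewrite inE; apply: (iffP (set0Pn _)) => [[i /color_partP[g ig]]|[i [g ig]]].
  by exists i, g.
by exists i; apply/color_partP; exists g.
Qed.

(** A coloring is a map from [n] to a union of free copies of G, indexed by T, and
    a zero None.  Its kernel has one block per copy that is reached, labeled by
    the values in G, and leaves out the points sent to None. *)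
Definition kernel_classes phi : {set {set labeled_set}} :=
  [set labeled_class (color_part phi a) | a in used phi].

Lemma kernel_is_partition phi : is_partial_partition (kernel_classes phi).
Proof.
apply/andP; split.
  apply/forall_inP => c /imsetP[a au ->]; apply/existsP.
  by exists (color_part phi a); rewrite eqxx; rewrite inE in au.
apply/forall_inP => c /imsetP[a au ->]; apply/forall_inP => c' /imsetP[b bu ->].
apply/implyP => ne; rewrite !block_class; apply/pred0P => i /=.
apply/negP => /andP[/color_partP[g ig] /color_partP[h]].
by rewrite ig => -[ab _]; rewrite ab eqxx in ne.
Qed.

Definition kernel phi : dowling n G := Dowling (kernel_is_partition phi).

Lemma card_kernel phi : #|classes_of (kernel phi)| = #|used phi|.
Proof.
apply: card_in_imset => a b /usedP[i [g ig]] _ ab.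
have : i \in carrier (color_part phi b).
  by rewrite -block_class -ab block_class; apply/color_partP; exists g.
by case/color_partP => h; rewrite ig => -[].
Qed.

End OneColorSet.

(** Each color of phi goes to None or, translated by one element of G, into one
    color of psi; points sent to None by phi are so by psi. *)
Definition refines (T T' : finType) (phi : coloring T) (psi : coloring T') :=
  (forall i, phi i = None -> psi i = None) /\
  (forall i j a g h b u, phi i = Some (a, g) -> phi j = Some (a, h) ->
     psi i = Some (b, u) -> psi j = Some (b, u * g^-1 * h)).

(** This reduces questions about the order to questions about maps. *)
Lemma kernel_leP (T T' : finType) (phi : coloring T) (psi : coloring T') :
  reflect (refines phi psi) (kernel phi <= kernel psi)%O.
Proof.
apply: (iffP (dowling_leP _ _)) => [le|[none same] c /imsetP[b bu ->]].
  have local i b u : psi i = Some (b, u) -> exists a g, phi i = Some (a, g) /\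
      forall j h, phi j = Some (a, h) -> psi j = Some (b, u * g^-1 * h).
    move=> ib; have bu : b \in used psi by apply/usedP; exists i, u.
    have [cov lab] := le _ (imset_f _ bu); rewrite block_class in cov lab.
    have ic : i \in carrier (color_part psi b) by apply/color_partP; exists u.
    have [e ek /andP[ie ec]] := cov i ic; have {}lab := lab e _ ek (labeled_class_id _) ec.
    case/imsetP: ek => a au eE; subst e; rewrite block_class in ie lab.
    have [g ig] := color_partP _ _ _ ie; exists a, g; split=> // j h jh.
    move: (labeled_class_id (restrict (color_part psi b) (carrier (color_part phi a)))).
    rewrite lab => /imsetP[q _ /ffunP qE].
    have := qE i; rewrite ffunE ie (color_part_some ib) ffunE (color_part_some ig) /=.
    case=> ->; have := qE j; rewrite ffunE.
    have jc : j \in carrier (color_part phi a) by apply/color_partP; exists h.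
    rewrite jc [in RHS]ffunE (color_part_some jh) /= mulgK ffunE.
    by case: (psi j) => // -[b' v]; case: eqP => // -> [->].
  split=> [i iN|i j a g h b u ia ja ib].
    case ib: (psi i) => [[b u]|] //.
    by have [a [g []]] := local i b u ib; rewrite iN.
  have [a' [g' [ia' /(_ j h)]]] := local i b u ib.
  by move: ia'; rewrite ia => -[<- <-]; apply.
rewrite block_class; split=> [i /color_partP[u ib]|e f /imsetP[a au ->]].
  case ia: (phi i) => [[a g]|]; last by rewrite none in ib.
  have au : a \in used phi by apply/usedP; exists i, g.
  exists (labeled_class (color_part phi a)); first exact: imset_f.
  rewrite block_class; apply/andP; split; first by apply/color_partP; exists g.
  apply/subsetP => j /color_partP[h ja]; apply/color_partP.
  by exists (u * g^-1 * h); apply: same ia ja ib.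
rewrite block_class => /imsetP[k _ ->] /subsetP sab.
rewrite restrict_relabel labeled_class_relabel.
have /usedP[i [g ia]] := au.
have ic : i \in carrier (color_part phi a) by apply/color_partP; exists g.
have /color_partP[u ib] := sab i ic.
have -> : restrict (color_part psi b) (carrier (color_part phi a)) =
    relabel (u * g^-1) (color_part phi a); last exact: labeled_class_relabel.
apply/ffunP => j; rewrite ffunE [in RHS]ffunE.
case: color_partP => [[h ja]|nj].
  by rewrite (color_part_some ja) (color_part_some (same _ _ _ _ _ _ _ ia ja ib)).
rewrite ffunE; case ja: (phi j) => [[a' h]|] //; case: eqP => // aE.
by case: nj; exists h; rewrite ja aE.
Qed.

(** The default is never reached: classes of a Dowling element are not empty. *)
Definition class_repr (c : {set labeled_set}) : labeled_set :=
  odflt [ffun=> None] [pick f in c].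

(** Every element is a kernel: the classes themselves serve as colors. *)
Definition coloring_of (x : dowling n G) : coloring {set labeled_set} :=
  [ffun i => if [pick c in classes_of x | i \in block c] is Some c
             then Some (c, odflt 1 (class_repr c i)) else None].

Lemma class_repr_in (x : dowling n G) c : c \in classes_of x -> class_repr c \in c.
Proof.
move=> cx; rewrite /class_repr; case: pickP => //= c0.
by have [_ [f fc] _ _] := dowlingP cx; have := c0 f; rewrite /= fc.
Qed.

Lemma coloring_ofE (x : dowling n G) c i : c \in classes_of x -> i \in block c ->
  coloring_of x i = Some (c, odflt 1 (class_repr c i)).
Proof.
move=> cx ic; rewrite ffunE; case: pickP => [c' /andP[c'x ic']|/(_ c)].
  by rewrite (dowling_eq cx c'x ic ic').
by rewrite cx ic.
Qed.

Lemma color_part_of (x : dowling n G) c : c \in classes_of x ->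
  color_part (coloring_of x) c = class_repr c.
Proof.
move=> cx; have cr := class_repr_in cx; have [_ _ _ carE] := dowlingP cx.
apply/ffunP => i; rewrite ffunE; case: (boolP (i \in block c)) => ic.
  rewrite (coloring_ofE cx ic) eqxx.
  by move: ic; rewrite -(carE _ cr) inE; case: (class_repr c i).
have -> : class_repr c i = None.
  by move: ic; rewrite -(carE _ cr) inE negbK => /eqP.
rewrite ffunE; case: pickP => // c' /andP[c'x ic'].
by case: eqP => // cE; rewrite -cE ic' in ic.
Qed.

Lemma used_coloring_of (x : dowling n G) : used (coloring_of x) = classes_of x.
Proof.
apply/setP => c; apply/usedP/idP => [[i [g]]|cx].
  by rewrite ffunE; case: pickP => // c' /andP[c'x _] [<-].
have [/set0Pn[i ic] _ _ _] := dowlingP cx.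
by exists i, (odflt 1 (class_repr c i)); apply: coloring_ofE.
Qed.

Lemma kernel_coloring_of (x : dowling n G) : kernel (coloring_of x) = x.
Proof.
apply: val_inj => /=; rewrite /kernel_classes used_coloring_of.
have cl c : c \in classes_of x -> labeled_class (color_part (coloring_of x) c) = c.
  move=> cx; have [_ _ clE _] := dowlingP cx.
  by rewrite color_part_of // -(clE _ (class_repr_in cx)).
apply/setP => c; apply/imsetP/idP => [[c' c'x ->]|cx]; first by rewrite cl.
by exists c; rewrite ?cl.
Qed.

Section CountRefined.
Variables (T T' : finType) (phi : coloring T).

(** A coloring refined by phi amounts to a free choice, for each color of phi, of
    None or of a pair (color, translation); spread and gather are this bijection. *)
Definition spread (xi : {ffun T -> option (T' * G)}) : coloring T' :=
  [ffun i => if phi i is Some (a, g) then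
               if xi a is Some (b, u) then Some (b, u * g) else None
             else None].

Definition gather (psi : coloring T') : {ffun T -> option (T' * G)} :=
  [ffun a => if [pick i in carrier (color_part phi a)] is Some i then
               if (color_part phi a i, psi i) is (Some g, Some (b, u))
               then Some (b, u * g^-1) else None
             else None].

Lemma spread_refined xi : refines phi (spread xi).
Proof.
split=> [i iN|i j a g h b u ia ja]; first by rewrite ffunE iN.
rewrite ffunE ia; case xa: (xi a) => [[b' u']|] // -[<- <-].
by rewrite ffunE ja xa mulgK.
Qed.

Lemma spreadK xi : xi \in pffun_on None (mem (used phi)) predT ->
  gather (spread xi) = xi.
Proof.
move=> /pffun_onP[/subsetP sup _]; apply/ffunP => a; rewrite ffunE.
case: pickP => [i /color_partP[g ia]|none]; last first.
  have au : a \notin used phi by apply/usedP => -[i [g ia]];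
    have := none i; rewrite (introT (color_partP _ _ _)) //; exists g.
  by apply/esym/eqP; apply: contraNT au => xa; apply: sup.
rewrite (color_part_some ia) ffunE ia.
by case: (xi a) => [[b u]|] //; rewrite mulgK.
Qed.

Lemma gatherK psi : refines phi psi -> spread (gather psi) = psi.
Proof.
move=> [none same]; apply/ffunP => j; rewrite ffunE.
case ja: (phi j) => [[a h]|]; last by rewrite none.
rewrite ffunE; case: pickP => [i /color_partP[g ia]|/(_ j)]; last first.
  by rewrite (introT (color_partP _ _ _)) //; exists h.
rewrite (color_part_some ia); case ib: (psi i) => [[b u]|].
  by rewrite (same _ _ _ _ _ _ _ ia ja ib).
case jb: (psi j) => [[b u]|] //.
by have := same _ _ _ _ _ _ _ ja ia jb; rewrite ib.
Qed.

Lemma gather_on psi : gather psi \in pffun_on None (mem (used phi)) predT.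
Proof.
apply/pffun_onP; split=> //; apply/subsetP => a; rewrite inE ffunE.
by case: pickP => [i ic _|//]; rewrite inE; apply/set0Pn; exists i.
Qed.

(** One free choice among 1 + |G| |T'| for each block of kernel phi. *)
Lemma card_refined :
  #|[set psi : coloring T' | kernel phi <= kernel psi]%O| =
  ((1 + #|{: G}| * #|T'|) ^ #|classes_of (kernel phi)|)%N.
Proof.
have -> : [set psi : coloring T' | (kernel phi <= kernel psi)%O] =
    spread @: [set xi in pffun_on None (mem (used phi)) predT].
  apply/setP => psi; rewrite inE; apply/kernel_leP/imsetP => [r|[xi _ ->]].
    by exists (gather psi); rewrite ?gatherK // inE gather_on.
  exact: spread_refined.
rewrite card_in_imset => [|xi xi']; last first.
  by rewrite !inE => xi_on xi'_on E; rewrite -(spreadK xi_on) E spreadK.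
rewrite cardsE card_pffun_on card_kernel; congr (_ ^ _)%N.
by rewrite card_option card_prod mulnC.
Qed.

End CountRefined.
End Colorings.

(** * Counting the elements above a given one *)

Section Blocks.
Variables (n : nat) (G : finGroupType).
Local Notation coloring T := {ffun 'I_n -> option (T * G)}.
Implicit Types x y z : dowling n G.

Definition blocks x : nat := #|classes_of x|.

Lemma blocks_kernel (T : finType) (phi : coloring T) : blocks (kernel phi) = #|used phi|.
Proof. exact: card_kernel. Qed.

(** f picks a color of phi inside each color of psi; it is injective because
    distinct colors are disjoint. *)
Lemma refines_colors (T T' : finType) (phi : coloring T) (psi : coloring T') :
  refines phi psi -> exists f : T' -> option T,
    {in used psi &, injective f} /\
    {in used psi, forall b, exists i a g u,
       [/\ f b = Some a, phi i = Some (a, g) & psi i = Some (b, u)]}.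
Proof.
move=> [none same].
pose f b := if [pick i in carrier (color_part psi b)] is Some i then
   omap fst (phi i) else None.
have fP b : b \in used psi -> exists i a g u,
    [/\ f b = Some a, phi i = Some (a, g) & psi i = Some (b, u)].
  move=> /usedP[j [v jb]]; rewrite /f.
  case: pickP => [i /color_partP[u ib]|/(_ j)]; last first.
    by rewrite (introT (color_partP _ _ _)) //; exists v.
  case ia: (phi i) => [[a g]|]; last by rewrite none in ib.
  by exists i, a, g, u.
exists f; split=> // b b' /fP[i [a [g [u [-> ia ib]]]]] /fP[i' [a' [g' [u' [-> ia' ib']]]]].
case=> aE; rewrite -aE in ia'.
by have := same _ _ _ _ _ _ _ ia ia' ib; rewrite ib' => -[].
Qed.

(** In the case of equality the injection of refines_colors is onto, so every color
    of phi lies in a color of psi that contains no other. *)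
Lemma leq_card_used (T T' : finType) (phi : coloring T) (psi : coloring T') :
  refines phi psi -> (#|used psi| <= #|used phi|)%N /\
  ((#|used phi| <= #|used psi|)%N -> refines psi phi).
Proof.
move=> r; have [f [fI fP]] := refines_colors r; have [none same] := r.
have sub : f @: used psi \subset Some @: used phi.
  apply/subsetP => _ /imsetP[b /fP[i [a [g [u [-> ia _]]]]] ->].
  by apply: imset_f; apply/usedP; exists i, g.
have cf : #|f @: used psi| = #|used psi| by apply: card_in_imset.
have cS : #|Some @: used phi| = #|used phi| by apply: card_imset => ? ? [].
split=> [|le]; first by rewrite -cf -cS subset_leq_card.
have {sub} onto a i g : phi i = Some (a, g) ->
    exists b u, psi i = Some (b, u) /\ f b = Some a.
  move=> ia; have : Some a \in f @: used psi.
    have /eqP -> : f @: used psi == Some @: used phi by rewrite eqEcard sub cf cS.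
    by apply: imset_f; apply/usedP; exists i, g.
  case/imsetP => b /fP[j [a' [h [u [fb ja jb]]]]]; rewrite fb => -[aE]; subst a'.
  by exists b, (u * h^-1 * g)%g; rewrite (same _ _ _ _ _ _ _ ja ia jb).
split=> [i iN|i j b u v a g ib jb ia].
  by case ia: (phi i) => [[a g]|] //; have [b [u []]] := onto a i g ia; rewrite iN.
have [b0 [u0 []]] := onto a i g ia; rewrite ib => -[<- _] fb {b0 u0}.
case ja: (phi j) => [[a' h]|]; last by rewrite none in jb.
have [b0 [u0 []]] := onto a' j h ja; rewrite jb => -[<- _]; rewrite fb => -[aE].
subst a'; have := same _ _ _ _ _ _ _ ia ja ib; rewrite jb => -[->].
by rewrite !mulgA mulgKV mulgV mul1g.
Qed.

Lemma blocks_anti x y : (x <= y)%O -> (blocks y <= blocks x)%N.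
Proof.
rewrite -(kernel_coloring_of x) -(kernel_coloring_of y) => /kernel_leP r.
by rewrite !blocks_kernel; have [] := leq_card_used r.
Qed.

Lemma blocks_lt x y : (x < y)%O -> (blocks y < blocks x)%N.
Proof.
move=> xy; rewrite ltnNge; apply/negP => le; move: xy; apply/negP.
rewrite lt_leAnge negb_and negbK; case: (boolP (x <= y)%O) => //= le'.
rewrite -(kernel_coloring_of x) -(kernel_coloring_of y) in le le' *.
move/kernel_leP: le' => r; apply/kernel_leP; have [_] := leq_card_used r; apply.
by rewrite -!blocks_kernel.
Qed.

Definition bottom_coloring : coloring 'I_n := [ffun i => Some (i, 1%g)].

Lemma kernel_bottom_le x : (kernel bottom_coloring <= x)%O.
Proof.
rewrite -(kernel_coloring_of x); apply/kernel_leP; split=> [i|i j a g h b u].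
  by rewrite ffunE.
by rewrite !ffunE => -[<- <-] [-> <-] ->; rewrite invg1 !mulg1.
Qed.

Lemma blocks_bottom : blocks (kernel bottom_coloring) = n.
Proof.
rewrite blocks_kernel -[RHS]card_ord -cardsT; congr #|pred_of_set _|.
by apply/setP => i; rewrite [RHS]inE; apply/usedP; exists i, 1%g; rewrite ffunE.
Qed.

Lemma blocks_le x : (blocks x <= n)%N.
Proof. by rewrite -[leqRHS]blocks_bottom; apply/blocks_anti/kernel_bottom_le. Qed.

Definition dowling_weight (m j : nat) : nat := (1 + m * j)%N.

(** Newton interpolation at 1 + m N, where the product of the z - a_i for i < j
    is m ^ j times a falling factorial. *)
Lemma whitney_colorings m k N :
  (\sum_(0 <= j < k.+1) whitney (dowling_weight m) k j * (m ^ j * N ^_ j) =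
   (1 + m * N) ^ k)%N.
Proof.
have fall j : (m ^ j * N ^_ j)%:R = \prod_(0 <= i < j)
    ((1 + m * N)%:R - (dowling_weight m i)%:R) :> int.
  elim: j => [|j IHj]; first by rewrite big_geq.
  rewrite big_nat_recr //= -IHj expnS ffactnSr mulnACA mulnC.
  case: (leqP j N) => jN; last by rewrite (ffact_small jN) !(muln0, mul0n, mul0r).
  by rewrite /dowling_weight !natrM natrB // !natrD !natrM; ring.
apply/eqP; rewrite -(eqr_nat int) natr_sum natrX -(whitney_newton (dowling_weight m)).
by apply/eqP; apply: eq_bigr => j _; rewrite natrM fall.
Qed.

Definition fiber N y := #|[set phi : coloring 'I_N | kernel phi == y]|.

Lemma sum_fiber N x :
  (\sum_(y : dowling n G | (x <= y)%O) fiber N y = (1 + #|{: G}| * N) ^ blocks x)%N.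
Proof.
have := @card_refined n G _ 'I_N (coloring_of x).
rewrite card_ord kernel_coloring_of => <-.
rewrite -[RHS]sum1_card.
rewrite (partition_big (fun phi => kernel phi) (fun y => (x <= y)%O)) => [|phi];
  last by rewrite inE.
apply: eq_bigr => y xy; rewrite /fiber -sum1_card; apply: eq_bigl => phi.
by rewrite !inE andbC; case: eqP => //= ->.
Qed.

Lemma fiber0 N y : (N < blocks y)%N -> fiber N y = 0%N.
Proof.
move=> Ny; apply/eqP; rewrite cards_eq0; apply/eqP/setP => phi; rewrite !inE.
apply/negP => /eqP E; move: Ny; rewrite -E blocks_kernel ltnNge.
by rewrite -[X in (_ <= X)%N]card_ord max_card.
Qed.

Definition count_ge x j := #|[set y | (x <= y)%O & blocks y == j]|.

Lemma count_ge_self x : count_ge x (blocks x) = 1%N.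
Proof.
rewrite /count_ge -(cards1 x); congr #|pred_of_set _|; apply/setP => y; rewrite !inE.
apply/andP/eqP => [[xy /eqP b]|->]; last by rewrite lexx eqxx.
apply/esym/eqP; move: xy; rewrite le_eqVlt => /orP[//|/blocks_lt].
by rewrite b ltnn.
Qed.

(** Strong induction on the number of blocks, together with the statement that
    m ^ k * N ^_ k colorings have a given kernel with k blocks.  Sorting the
    (1 + m N)^k colorings above x by kernel gives an identity for each N which,
    for N < k, involves no coloring with kernel x and is triangular in the
    unknowns; whitney_colorings provides the same system for whitney. *)
Lemma count_ge_whitney x j : (j <= blocks x)%N ->
  count_ge x j = whitney (dowling_weight #|{: G}|) (blocks x) j.
Proof.
pose m := #|{: G}|; have m0 : (0 < m)%N by apply/card_gt0P; exists 1%g.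
suff [ + _] : (forall j, (j <= blocks x)%N ->
    count_ge x j = whitney (dowling_weight m) (blocks x) j) /\
  forall N, fiber N x = (m ^ blocks x * N ^_ blocks x)%N by apply.
have [k] := ubnP (blocks x); elim: k x {j} => // k IHk x; rewrite ltnS => xk.
have split N : (\sum_(0 <= j < blocks x) count_ge x j * (m ^ j * N ^_ j) +
    fiber N x = (1 + m * N) ^ blocks x)%N.
  rewrite -sum_fiber (bigD1 x) //= addnC; congr (_ + _)%N.
  rewrite (eq_bigr (fun y => m ^ blocks y * N ^_ blocks y)%N) => [|y /andP[xy yx]].
    have lt y : (x <= y)%O && (y != x) = (x < y)%O by rewrite lt_neqAle eq_sym andbC.
    rewrite (eq_bigl _ _ lt).
    rewrite (@sum_by_level _ _ _ _ (blocks x) (fun j => m ^ j * N ^_ j)%N) =>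
      [|y /blocks_lt //].
    apply: eq_big_nat => j /andP[_ jx]; rewrite -mulr_natl natn.
    congr (_ * _)%N; apply: eq_card => y; rewrite !inE -lt.
    case: (eqVneq y x) => [->|_]; last by rewrite andbT.
    by rewrite (gtn_eqF jx) !andbF.
  apply: (IHk _ _).2; apply: leq_trans xk; apply: blocks_lt.
  by rewrite lt_neqAle xy eq_sym yx.
have eqW j : (j < blocks x)%N -> count_ge x j = whitney (dowling_weight m) (blocks x) j.
  have [l] := ubnP j; elim: l j => // l IHl j; rewrite ltnS => jl jx.
  (* At N = j the falling factorials of order above j vanish. *)
  have cut F r : (j < r)%N -> (\sum_(0 <= i < r) F i * (m ^ i * j ^_ i) =
      \sum_(0 <= i < j) F i * (m ^ i * j ^_ i) + F j * (m ^ j * j ^_ j))%N.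
    move=> jr; rewrite (big_cat_nat (leq0n j) (ltnW jr)) /=; congr (_ + _)%N.
    rewrite big_ltn // big_nat big1 ?addn0 // => i /andP[ji _].
    by rewrite ffact_small // !muln0.
  have := split j; rewrite -whitney_colorings fiber0 // addn0.
  rewrite (cut _ _ jx) (cut _ _ (leqW jx)).
  rewrite (eq_big_nat _ _ (F2 := fun i => whitney (dowling_weight m) (blocks x) i *
     (m ^ i * j ^_ i)))%N => [|i /andP[_ ij]]; last first.
    by rewrite IHl //; lia.
  have f0 : (0 < m ^ j * j ^_ j)%N by rewrite muln_gt0 expn_gt0 m0 ffact_gt0 leqnn.
  move/addnI/eqP; rewrite eqn_pmul2r //.
  by move/eqP.
split=> [j|N].
  by rewrite leq_eqVlt => /orP[/eqP->|/eqW//]; rewrite count_ge_self whitneynn.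
have := split N; rewrite -whitney_colorings big_nat_recr //= whitneynn mul1n.
rewrite (eq_big_nat _ _ (F2 := fun i => whitney (dowling_weight m) (blocks x) i *
     (m ^ i * N ^_ i)))%N => [|i /andP[_ ij]]; last by rewrite eqW.
by move/addnI.
Qed.

End Blocks.
Arguments blocks {n G} x.

(** * Rank and conclusion *)

Section Rank.
Variables (n : nat) (G : finGroupType).
Local Notation coloring T := {ffun 'I_n -> option (T * G)}.
Implicit Types x y z : dowling n G.

(** Recoloring i0 with a new color makes it a block of its own, and splits it off
    from its block in the kernel. *)
Definition isolate (T : finType) (phi : coloring T) (i0 : 'I_n) : coloring (option T) :=
  [ffun i => if i == i0 then Some (None, 1%g)
             else omap (fun p => (Some p.1, p.2)) (phi i)].

Lemma isolate_refines (T : finType) (phi : coloring T) i0 :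
  refines (isolate phi i0) phi.
Proof.
split=> [i|i j a g h b u]; rewrite !ffunE.
  by case: eqP => // _; case: (phi i).
case: (eqVneq i i0) => [->|_]; case: (eqVneq j i0) => [->|_].
- by move=> -[<- <-] [<-] ->; rewrite invg1 !mulg1.
- by move=> -[<- _]; case: (phi j) => // -[].
- by case: (phi i) => // -[? ?] [<- _].
case: (phi i) => // -[a' g'] [<- <-]; case: (phi j) => // -[a'' h'] [-> <-].
by case=> -> ->; rewrite mulgV mul1g.
Qed.

(** With fewer than n colors some point is uncolored or shares its color;
    isolating it loses no color. *)
Lemma exists_isolate (T : finType) (phi : coloring T) :
  (#|used phi| < n)%N ->
  exists i0, #|used (isolate phi i0)| = #|used phi|.+1.
Proof.
move=> lt.
have [i0 shared] : exists i0, forall a g, phi i0 = Some (a, g) ->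
    exists j h, j != i0 /\ phi j = Some (a, h).
  pose color i := omap fst (phi i).
  case: (pickP (fun i => ~~ ((color i != None) &&
      [forall j, (color j == color i) ==> (j == i)]))) => [i0 nal|al].
    exists i0 => a g ia; move: nal; rewrite /color ia /= => /forallPn[j].
    rewrite negb_imply; case ja: (phi j) => [[b h]|] //= /andP[/eqP[bE] ji].
    by exists j, h; rewrite ja bE.
  have {}al i : (color i != None) && [forall j, (color j == color i) ==> (j == i)].
    exact/negbFE/al.
  move: lt; rewrite ltnNge => /negP[].
  (* Otherwise every point is colored, and colors separate the points. *)
  have cI : injective color.
    move=> j i E; have /andP[_ /forallP/(_ j)] := al i.
    by rewrite E eqxx => /eqP.
  have SI : injective (@Some T) by move=> ? ? [].
  rewrite -[leqLHS]card_ord -cardsT -(card_imset _ cI) -(card_imset _ SI).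
  apply: subset_leq_card; apply/subsetP => _ /imsetP[i _ ->].
  have /andP[+ _] := al i; rewrite /color; case ia: (phi i) => [[a g]|] //= _.
  by apply: imset_f; apply/usedP; exists i, g.
exists i0.
have -> : used (isolate phi i0) = None |: Some @: used phi.
  apply/setP => c; apply/usedP/setU1P => [[i [g]]|].
    rewrite ffunE; case: eqP => [_ [<-]|_]; first by left.
    case ia: (phi i) => [[a h]|] //= -[<- _]; right; apply: imset_f.
    by apply/usedP; exists i, h.
  case=> [->|/imsetP[a /usedP[i [g ia]] ->]].
    by exists i0, 1%g; rewrite ffunE eqxx.
  case: (eqVneq i i0) => [iE|ne]; last by exists i, g; rewrite ffunE (negbTE ne) ia.
  rewrite iE in ia; have [j [h [ne ja]]] := shared a g ia.
  by exists j, h; rewrite ffunE (negbTE ne) ja.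
rewrite cardsU1 card_imset => [|? ? []//].
by rewrite (_ : None \notin _) //; apply/imsetP => -[].
Qed.

Lemma exists_refinement x : (blocks x < n)%N ->
  exists2 y, (y < x)%O & blocks y = (blocks x).+1.
Proof.
rewrite -{1}(kernel_coloring_of x) blocks_kernel => /exists_isolate[i0 b1].
have bx : #|used (coloring_of x)| = blocks x by rewrite -blocks_kernel kernel_coloring_of.
exists (kernel (isolate (coloring_of x) i0)); last by rewrite blocks_kernel b1 bx.
rewrite lt_neqAle -{4}(kernel_coloring_of x).
rewrite (introT (kernel_leP _ _) (isolate_refines _ _)).
rewrite andbT; apply: contra_eq_neq b1 => E.
by rewrite -blocks_kernel E bx neq_ltn ltnSn.
Qed.

Lemma blocks_chain (A : {set dowling n G}) : is_chain A -> {in A &, injective blocks}.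
Proof.
move=> cA y z yA zA; have := chain_total cA yA zA.
by case: comparableP => //= [/blocks_lt lt|/blocks_lt lt] _ E; rewrite E ltnn in lt.
Qed.

Lemma exists_chain_below x : exists A : {set dowling n G},
  [/\ is_chain A, [forall y in A, (y < x)%O] & #|A| = (n - blocks x)%N].
Proof.
have [k] := ubnP (n - blocks x); elim: k x => // k IHk x; rewrite ltnS => xk.
case: (ltnP (blocks x) n) => [xn|nx]; last first.
  exists set0; split; first by apply/forall_inP => y; rewrite inE.
    by apply/forall_inP => y; rewrite inE.
  by rewrite cards0; lia.
have [y yx by1] := exists_refinement xn.
have [|A [cA /forall_inP Ay cardA]] := IHk y; first by lia.
exists (y |: A); split.
- rewrite chain_insert // => z /Ay zy.
  by rewrite comparable_sym lt_comparable.
- apply/forall_inP => z /setU1P[->//|/Ay zy]; exact: lt_trans yx.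
rewrite cardsU1 cardA (_ : y \notin A); first by lia.
by apply/negP => /Ay; rewrite ltxx.
Qed.

(** The number of blocks drops strictly along a chain, and one can go down from x
    adding one block at a time. *)
Lemma poset_rank_blocks x : poset_rank x = (n - blocks x)%N.
Proof.
apply/eqP; rewrite eqn_leq; apply/andP; split; last first.
  have [A [cA Ax <-]] := exists_chain_below x.
  by rewrite /poset_rank (bigD1 A) ?cA ?Ax //= leq_maxl.
apply/bigmax_leqP => A /andP[cA /forall_inP Ax].
pose f y : 'I_n.+1 := inord (blocks y).
have fE y : f y = blocks y :> nat by rewrite inordK // ltnS blocks_le.
rewrite -(card_in_imset (f := f)) => [|y z yA zA fyz]; last first.
  by apply: (blocks_chain cA) => //; rewrite -!fE fyz.
apply: (@leq_trans #|[set i : 'I_n.+1 | (blocks x < i)%N]|).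
  apply: subset_leq_card; apply/subsetP => _ /imsetP[y /Ax yx ->].
  by rewrite inE fE blocks_lt.
by rewrite -sum1_card (eq_bigl (fun i : 'I_n.+1 => true && (blocks x < val i)%N)) => [|i];
  rewrite ?inE // -(big_geq_mkord (blocks x).+1 n.+1 xpredT (fun=> 1%N));
  rewrite ?sum_nat_const_nat ?muln1 ?subSS.
Qed.

End Rank.

Section Selection.
Variables (R : realType) (n : nat) (G : finGroupType).
Variables (d : Order.disp_t) (P : finPOrderType d) (v : P -> dowling n G).
Variable tau : pred nat.
Hypothesis v_inj : injective v.
Hypothesis v_lt : forall x y : P, (x < y)%O = (v x < v y)%O.
Hypothesis v_codom : forall z, (z \in codom v) = tau (blocks z).

Lemma card_level (Q : pred (dowling n G)) (j : nat) :
  #|[set y : P | Q (v y) & blocks (v y) == j]| =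
  if tau j then #|[set z : dowling n G | Q z & blocks z == j]| else 0%N.
Proof.
case: ifP => tj; last first.
  apply/eqP; rewrite cards_eq0; apply/eqP/setP => y; rewrite !inE.
  apply/negP => /andP[_ /eqP bj].
  by have := codom_f v y; rewrite v_codom bj tj.
rewrite -(card_imset _ v_inj); congr #|pred_of_set _|; apply/setP => z.
apply/imsetP/idP => [[y + ->]|]; first by rewrite !inE.
rewrite inE => /andP[Qz /eqP bz].
have /codomP[y zE] : z \in codom v by rewrite v_codom bz.
by exists y; rewrite // inE -zE Qz bz eqxx.
Qed.

(** P stands for a subposet given by numbers of blocks: the whole lattice or a
    rank selection, the rank being n minus the number of blocks. *)
Lemma chain_poly_selection : chain_poly P R =
  (1 + 'X) ^+ (tau n + ((0 < n)%N && tau 0%N)) *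
  core (dowling_weight #|{: G}|) tau 'X n.
Proof.
rewrite exprD -mulrA -/(level_poly R _ tau n).
apply: (@chain_poly_levels R _ tau _ d P (blocks \o v) n) => //=.
- by rewrite /dowling_weight muln0.
- by move=> x y; rewrite v_lt; apply: blocks_lt.
- by move=> x; apply: blocks_le.
- move=> x j jx; under eq_finset do rewrite v_lt.
  rewrite (card_level (fun z => v x < z)%O) /level_count -count_ge_whitney ?(ltnW jx) //.
  case: ifP => // _; apply: eq_card => z; rewrite !inE lt_neqAle.
  by case: eqVneq => [<-|]; rewrite ?(gtn_eqF jx) ?andbF.
move=> j jn; have := card_level xpredT j.
rewrite /= => ->; rewrite /level_count -[n in whitney _ n](blocks_bottom n G).
rewrite -count_ge_whitney ?blocks_bottom //; case: ifP => // _.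
by apply: eq_card => z; rewrite !inE kernel_bottom_le.
Qed.

End Selection.

Theorem corollary4p2 (R : realType) (G : finGroupType) :
  (forall n : nat,
     [/\ real_rooted (chain_poly (dowling n G) R),
         (forall x : R, root (chain_poly (dowling n G) R) x ->
            -1 <= x <= 0) &
         interlaces (chain_poly (dowling n G) R)
                    (chain_poly (dowling n.+1 G) R)]) /\
  (forall (S : set nat) (n : nat),
     real_rooted (chain_poly (rank_selected (dowling n G) S) R) /\
     (forall x : R, root (chain_poly (rank_selected (dowling n G) S) R) x ->
        -1 <= x <= 0)).
Proof.
have weight0 : dowling_weight #|{: G}| 0 != 0%N by [].
have full n : chain_poly (dowling n G) R = (1 + 'X) ^+ (1 + (0 < n)) *
    core (dowling_weight #|{: G}|) predT 'X n.
  rewrite (@chain_poly_selection R n G _ _ id predT) ?andbT //.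
  by move=> z; apply/codomP; exists z.
split=> [n|S n].
  rewrite !full; split; first exact: real_rooted_core.
    by move=> x; apply: root_core_itv.
  exact: interlaces_core.
have -> := @chain_poly_selection R n G _ (rank_selected (dowling n G) S) val
  (fun j => (n - j)%N \in S) val_inj.
- by split; [exact: real_rooted_core | move=> x; apply: root_core_itv].
- by move=> x y; rewrite -lt_val.
move=> z; rewrite -poset_rank_blocks; apply/codomP/idP => [[y ->]|zS].
  exact: (valP y).
by exists (Sub z zS); rewrite SubK.
Qed.
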